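(* Let $$\gamma_0=\frac{\sqrt3}{\pi}\,\Gamma\left(\tfrac13\right)^2\quad\text{and}\quad\gamma_1=3\log(192)-6\log\left(\gamma_0^3-\gamma_0^{-3}\right).$$ Then for every $\zeta\in S^1=\{\zeta\in\mathbb{C}:|\zeta|=1\}$ one has $$\left|g_{\mathrm{hyp}}(\zeta)-\left(\gamma_1-\frac{\Re(\zeta)}{13824}\right)\right|\le5\cdot10^{-7}.$$
   Context: $\Gamma$ is Euler's Gamma function. Let $\mathbb{H}=\{\tau\in\mathbb{C}:\Im(\tau)>0\}$, let $\Delta(\tau)=q\prod_{n\ge1}(1-q^n)^{24}$ with $q=e^{2\pi i\tau}$, and let $g_\infty:\mathbb{H}\to\mathbb{R}$, $g_\infty(\tau)=-\log\left((4\pi\Im(\tau))^6|\Delta(\tau)|\right)$, which is $\mathrm{SL}_2(\mathbb{Z})$-invariant. Let $j:\mathbb{H}\to\mathbb{C}$ be the modular $j$-invariant, $j(\tau)=\frac1q+744+\cdots$. The function $g_{\mathrm{hyp}}:\mathbb{C}\to\mathbb{R}$ is defined by $g_\infty=g_{\mathrm{hyp}}\circ j$. *)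

(* Defs.v *)
From Stdlib Require Import Reals List.
From Coquelicot Require Import Coquelicot.
Open Scope R_scope.

(* Euler's integral of the second kind; meant for 0 < x. *)
Definition Gamma (x : R) : R :=
  RInt_gen (fun t => Rpower t (x - 1) * exp (- t))
    (at_right 0) (Rbar_locally p_infty).

Definition Cexp (z : C) : C := (exp (Re z) * cos (Im z), exp (Re z) * sin (Im z)).

(* [iota P] is the unique element satisfying [P] when there is one. *)
Definition Clim_seq (u : nat -> C) : C :=
  iota (T := C_CompleteNormedModule)
    (fun l : C_NormedModule => filterlim u eventually (locally l)).

Definition CSeries (a : nat -> C) : C :=
  iota (T := C_CompleteNormedModule)
    (fun l : C_NormedModule => is_series (V := C_NormedModule) a l).

(* u 0 * ... * u (n - 1) *)
Fixpoint Cprod (u : nat -> C) (n : nat) : C :=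
  match n with
  | O => 1%C
  | S m => (Cprod u m * u m)%C
  end.

Definition nome (tau : C) : C := Cexp (2 * PI * Ci * tau)%C.

(* The factor indexed by k is that of exponent n = k + 1. *)
Definition modular_Delta (tau : C) : C :=
  (nome tau * Clim_seq (Cprod (fun k => (1 - nome tau ^ S k) ^ 24)))%C.

(* Sum of the cubes of the positive divisors of n. *)
Definition sigma3 (n : nat) : nat :=
  list_sum (map (fun d => Nat.pow d 3)
    (filter (fun d => Nat.eqb (Nat.modulo n d) 0) (seq 1 n))).

(* Normalised Eisenstein series of weight 4; the term of index k is that of
   n = k + 1. *)
Definition E4 (tau : C) : C :=
  (1 + 240 * CSeries (fun k => INR (sigma3 (S k)) * nome tau ^ S k))%C.

(* This normalisation has q-expansion 1/q + 744 + ... *)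
Definition j_inv (tau : C) : C := (E4 tau ^ 3 / modular_Delta tau)%C.

Definition g_infty (tau : C) : R :=
  - ln ((4 * PI * Im tau) ^ 6 * Cmod (modular_Delta tau)).

Definition gamma0 : R := sqrt 3 / PI * Gamma (1 / 3) ^ 2.

Definition gamma1 : R := 3 * ln 192 - 6 * ln (gamma0 ^ 3 - / gamma0 ^ 3).

(* Main.v *)
(** Let rho = 1/2 + i sqrt 3 / 2 be the zero of [E4], put w = 2 pi i (tau - rho) and let
    s = (tau - rho) / (tau - conj rho), a Moebius function of w.  Up to constants,
    g_infty(tau) = - 6 ln (1 - |s|^2) - ln |Delta(tau) (1 - s)^(-12)|.  By the symmetry of
    order 3 at rho, the second argument is a power series in s^3 and E4(tau) (1 - s)^(-4) is s
    times such a series, so that the cube root of j is s / S (1 + O(s^3)) with S = gamma0^(-3)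
    close to 0.016.  On |j| = 1 the term |s|^2 is therefore gamma0^(-6) up to a relative error
    of about 10^(-4), and the s^3 term of the logarithm of the second argument is Re j / 13824.

    None of this needs the modularity of [E4] and [modular_Delta], or the Chowla-Selberg formula
    for their values at rho: the Taylor coefficients at rho (those that vanish by symmetry being
    only shown to be tiny), Gamma(1/3) and the constant term are enclosed numerically, since the
    series in q = - exp (- pi sqrt 3) exp w converge very fast.  The point tau with
    j(tau) = zeta comes from a contraction in w. *)

(* Since j has a triple zero at rho, j(tau) = zeta is a degenerate equation in w. A cube root u of
   zeta turns it into a relation between E4 and the cube root of Delta whose derivative in w is
   close to -1 near 0, so that Newton's iteration with a frozen derivative contracts. As g_infty =
   g_hyp o j, the one point tau so obtained already gives g_hyp(zeta).

   The tolerance 5 / 10 ^ 7 shapes the estimates. Most of it is spent on 6 ln (1 - |s| ^ 2), because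
   the s ^ 4 term of E4 is bounded and not computed, which leaves |s| uncertain by a relative 8 / 10
   ^ 5. Even this is out of reach on the disc of radius 3 / 10 where the contraction lives, so the
   solution is first confined to a smaller disc. Logarithms are never enclosed: they are compared in
   pairs through ln x <= x - 1, and everything else reduces to comparisons of integers. *)
Require Import Defs.
From Stdlib Require Import Reals List ZArith Lra Lia Machin.
From Coquelicot Require Import Coquelicot.
Import ListNotations.
Open Scope R_scope.

(** * Interval arithmetic *)

(** Evaluated once, so that [vm_compute], [lra] and [nra] all meet a numeral. *)
Definition scale : Z := Eval vm_compute in (10 ^ 25)%Z.

(* The pair [I] of integers stands for the interval [fst I / scale, snd I / scale]. *)
Definition encl (I : Z * Z) (x : R) : Prop :=
  IZR (fst I) <= x * IZR scale <= IZR (snd I).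

(** The ceiling, for positive [q]: [Z.div] takes the floor, and the two together round both ends of
    an interval outwards. *)
Definition cdiv (p q : Z) : Z := (- ((- p) / q))%Z.

Definition iadd (I J : Z * Z) := (fst I + fst J, snd I + snd J)%Z.
Definition iopp (I : Z * Z) := (- snd I, - fst I)%Z.
Definition imul (I J : Z * Z) :=
  let p1 := (fst I * fst J)%Z in let p2 := (fst I * snd J)%Z in
  let p3 := (snd I * fst J)%Z in let p4 := (snd I * snd J)%Z in
  (Z.div (Z.min (Z.min p1 p2) (Z.min p3 p4)) scale,
   cdiv (Z.max (Z.max p1 p2) (Z.max p3 p4)) scale).
(* Only meant for positive [fst I]. *)
Definition iinv (I : Z * Z) :=
  (Z.div (scale * scale) (snd I), cdiv (scale * scale) (fst I)).
Definition icst (p : Z) := (p * scale, p * scale)%Z.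
Fixpoint ipow (I : Z * Z) (n : nat) :=
  match n with O => icst 1 | S m => imul I (ipow I m) end.

Lemma scale_pos : 0 < IZR scale.
Proof. apply IZR_lt; reflexivity. Qed.

Lemma IZR_div_le (p q : Z) : (0 < q)%Z -> IZR (p / q) <= IZR p / IZR q.
Proof.
  intros Hq. assert (0 < IZR q) by (apply IZR_lt; auto).
  apply Rmult_le_reg_r with (IZR q); auto.
  unfold Rdiv; rewrite Rmult_assoc, Rinv_l, Rmult_1_r by lra.
  rewrite <- mult_IZR; apply IZR_le.
  rewrite Z.mul_comm; apply Z.mul_div_le; auto.
Qed.

Lemma IZR_cdiv_ge (p q : Z) : (0 < q)%Z -> IZR p / IZR q <= IZR (cdiv p q).
Proof.
  intros Hq. unfold cdiv. rewrite opp_IZR.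
  pose proof (IZR_div_le (- p) q Hq) as H. rewrite opp_IZR in H.
  unfold Rdiv in *; lra.
Qed.

Lemma encl_cst (p : Z) : encl (icst p) (IZR p).
Proof. unfold encl, icst; cbn [fst snd]; rewrite mult_IZR; lra. Qed.

Lemma encl_add I J x y : encl I x -> encl J y -> encl (iadd I J) (x + y).
Proof. unfold encl, iadd; cbn [fst snd]; rewrite !plus_IZR; lra. Qed.

Lemma encl_opp I x : encl I x -> encl (iopp I) (- x).
Proof. unfold encl, iopp; cbn [fst snd]; rewrite !opp_IZR; lra. Qed.

Lemma encl_sub I J x y : encl I x -> encl J y -> encl (iadd I (iopp J)) (x - y).
Proof. intros; apply encl_add; auto using encl_opp. Qed.

(** A product is affine in each factor, so its extremes over a rectangle are reached at the
    corners. *)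
Lemma mul_between (l1 h1 l2 h2 x y m M : R) :
  l1 <= x <= h1 -> l2 <= y <= h2 ->
  m <= l1 * l2 <= M -> m <= l1 * h2 <= M -> m <= h1 * l2 <= M ->
  m <= h1 * h2 <= M -> m <= x * y <= M.
Proof.
  intros Hx Hy H1 H2 H3 H4.
  assert (A1 : m <= l1 * y <= M).
  { destruct (Rle_lt_dec 0 l1); split; nra. }
  assert (A2 : m <= h1 * y <= M).
  { destruct (Rle_lt_dec 0 h1); split; nra. }
  destruct (Rle_lt_dec 0 y); split; nra.
Qed.

Lemma encl_mul I J x y : encl I x -> encl J y -> encl (imul I J) (x * y).
Proof.
  unfold encl, imul; cbn [fst snd]. intros Hx Hy.
  set (p1 := (fst I * fst J)%Z); set (p2 := (fst I * snd J)%Z);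
  set (p3 := (snd I * fst J)%Z); set (p4 := (snd I * snd J)%Z).
  set (m := Z.min (Z.min p1 p2) (Z.min p3 p4)).
  set (M := Z.max (Z.max p1 p2) (Z.max p3 p4)).
  pose proof scale_pos as Hs.
  assert (Hb : IZR m <= (x * IZR scale) * (y * IZR scale) <= IZR M).
  { apply (mul_between _ _ _ _ _ _ _ _ Hx Hy);
      rewrite <- mult_IZR; split; apply IZR_le; unfold m, M, p1, p2, p3, p4; lia. }
  pose proof (IZR_div_le m scale eq_refl).
  pose proof (IZR_cdiv_ge M scale eq_refl).
  assert (E : x * y * IZR scale
              = (x * IZR scale) * (y * IZR scale) / IZR scale) by (field; lra).
  rewrite E. split.
  - eapply Rle_trans; [eassumption|]. apply Rmult_le_compat_r; [|lra].
    left; apply Rinv_0_lt_compat; auto.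
  - eapply Rle_trans; [|eassumption]. apply Rmult_le_compat_r; [|lra].
    left; apply Rinv_0_lt_compat; auto.
Qed.

(** When 0 lies inside [I] the lower end is negative: sound, though not the sharp value 0. *)
Definition iabs (I : Z * Z) := (Z.max (fst I) (- snd I), Z.max (- fst I) (snd I)).

Lemma encl_abs I x : encl I x -> encl (iabs I) (Rabs x).
Proof.
  unfold encl, iabs; cbn [fst snd]. intros [H1 H2]. pose proof scale_pos.
  unfold Rabs; destruct (Rcase_abs x);
    destruct (Z.max_spec (fst I) (- snd I)) as [[? ->]|[? ->]];
    destruct (Z.max_spec (- fst I) (snd I)) as [[Hm ->]|[Hm ->]];
    try apply IZR_lt in Hm; try apply IZR_le in Hm;
    rewrite ?opp_IZR in *; split; nra.
Qed.

Lemma encl_inv I x : Z.ltb 0 (fst I) = true -> encl I x -> encl (iinv I) (/ x).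
Proof.
  unfold encl, iinv; cbn [fst snd]. rewrite Z.ltb_lt. intros H0 [H1 H2].
  pose proof scale_pos as Hs.
  assert (H0' : 0 < IZR (fst I)) by (apply IZR_lt; auto).
  assert (Hx : 0 < x * IZR scale) by lra.
  assert (Hx' : 0 < x) by nra.
  assert (H3 : 0 < IZR (snd I)) by lra.
  assert (E : / x * IZR scale = IZR (scale * scale) / (x * IZR scale)).
  { rewrite mult_IZR; field; lra. }
  assert (0 <= IZR (scale * scale)) by (rewrite mult_IZR; nra).
  rewrite E; split.
  - eapply Rle_trans; [apply IZR_div_le; apply lt_IZR; auto|].
    apply Rmult_le_compat_l; auto. apply Rinv_le_contravar; auto.
  - eapply Rle_trans; [|apply IZR_cdiv_ge; auto].
    apply Rmult_le_compat_l; auto. apply Rinv_le_contravar; auto.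
Qed.

Lemma encl_div I J x y : Z.ltb 0 (fst J) = true -> encl I x -> encl J y ->
  encl (imul I (iinv J)) (x / y).
Proof. intros; apply encl_mul; auto using encl_inv. Qed.

Lemma encl_ratio (p q : Z) : Z.ltb 0 q = true ->
  encl (Z.div (p * scale) q, cdiv (p * scale) q) (IZR p / IZR q).
Proof.
  rewrite Z.ltb_lt. intros Hq. assert (0 < IZR q) by (apply IZR_lt; auto).
  unfold encl; cbn [fst snd].
  replace (IZR p / IZR q * IZR scale) with (IZR (p * scale) / IZR q)
    by (rewrite mult_IZR; field; lra).
  split; [apply IZR_div_le|apply IZR_cdiv_ge]; auto.
Qed.

Lemma encl_pow I x n : encl I x -> encl (ipow I n) (x ^ n).
Proof.
  intros H; induction n as [|n IH]; cbn [ipow pow].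
  - apply encl_cst.
  - apply encl_mul; auto.
Qed.

Lemma encl_le I J x y : encl I x -> encl J y -> Z.leb (snd I) (fst J) = true -> x <= y.
Proof.
  unfold encl; rewrite Z.leb_le; intros H1 H2 H.
  apply IZR_le in H. pose proof scale_pos. nra.
Qed.

Lemma encl_lt I J x y : encl I x -> encl J y -> Z.ltb (snd I) (fst J) = true -> x < y.
Proof.
  unfold encl; rewrite Z.ltb_lt; intros H1 H2 H.
  apply IZR_lt in H. pose proof scale_pos. nra.
Qed.

Lemma encl_weaken I J x : encl I x ->
  andb (Z.leb (fst J) (fst I)) (Z.leb (snd I) (snd J)) = true -> encl J x.
Proof.
  unfold encl; rewrite Bool.andb_true_iff, !Z.leb_le; intros H1 [H2 H3].
  apply IZR_le in H2; apply IZR_le in H3; lra.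
Qed.

(* Holds the enclosures of the named constants. Opacity keeps [eauto] from unfolding one real number
   in order to match another. *)
Create HintDb encl discriminated.
#[global] Hint Constants Opaque : encl.

(** The interval is an existential variable that the syntax of the real number instantiates. The
    positivity of a divisor is postponed until its interval is known. *)
Ltac enclose :=
  lazymatch goal with
  | |- encl _ (IZR _) => apply encl_cst
  | |- encl _ (_ + _) => eapply encl_add; enclose
  | |- encl _ (_ - _) => eapply encl_sub; enclose
  | |- encl _ (Rabs _) => eapply encl_abs; enclose
  | |- encl _ (- _) => eapply encl_opp; enclose
  | |- encl _ (_ * _) => eapply encl_mul; enclose
  | |- encl _ (/ _) => eapply encl_inv; [|enclose]; [vm_compute; reflexivity]
  | |- encl _ (IZR _ / IZR _) => apply encl_ratio; reflexivity
  | |- encl _ (_ / _) => eapply encl_div; [|enclose|enclose]; [vm_compute; reflexivity]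
  | |- encl _ (_ ^ _) => eapply encl_pow; enclose
  | |- _ => solve [eauto with encl]
  end.

Ltac enclose_cmp :=
  lazymatch goal with
  | |- Rabs _ <= _ => apply Rabs_le; split; enclose_cmp
  | |- _ /\ _ => split; enclose_cmp
  | |- _ <= _ => eapply encl_le; [enclose|enclose|vm_compute; reflexivity]
  | |- _ < _ => eapply encl_lt; [enclose|enclose|vm_compute; reflexivity]
  | |- _ >= _ => apply Rle_ge; enclose_cmp
  | |- encl _ _ => eapply encl_weaken; [enclose|vm_compute; reflexivity]
  end.

Ltac INR_literal := rewrite !INR_IZR_INZ; cbn [Z.of_nat Pos.of_succ_nat Pos.succ].

Lemma encl_sqrt3 : encl (17320508075688772935274463, 17320508075688772935274464)%Z (sqrt 3).
Proof.
  assert (Hs : sqrt 3 * sqrt 3 = 3) by (apply sqrt_sqrt; lra).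
  assert (H0 := sqrt_pos 3).
  unfold encl, scale; cbn [fst snd]; split; nra.
Qed.
#[local] Hint Resolve encl_sqrt3 : encl.

Lemma encl_PI : encl (31415926535897932000000000, 31415926535897933000000000)%Z PI.
Proof.
  (* Machin-type formula pi / 4 = 2 arctan (1/3) + arctan (1/7): the two alternating partial sums
     differ by about 10 ^ (-20). *)
  pose proof (PI_2_3_7_ineq 9) as [H1 H2].
  assert (A1 : 31415926535897932 / 40000000000000000 <= PI / 4).
  { eapply Rle_trans; [|exact H1].
    cbv [Nat.mul Nat.add sum_f_R0 tg_alt PI_2_3_7_tg Ratan_seq].
    INR_literal.
    enclose_cmp. }
  assert (A2 : PI / 4 <= 31415926535897933 / 40000000000000000).
  { eapply Rle_trans; [exact H2|].
    cbv [Nat.mul Nat.add sum_f_R0 tg_alt PI_2_3_7_tg Ratan_seq].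
    INR_literal.
    enclose_cmp. }
  unfold encl, scale; cbn [fst snd]; split; lra.
Qed.
#[local] Hint Resolve encl_PI : encl.

(** * The exponential and Gamma(1/3) *)

Fixpoint exp_term (x : R) (n : nat) : R :=
  match n with O => 1 | S m => exp_term x m * x / IZR (Z.of_nat n) end.

Fixpoint exp_sum (x : R) (n : nat) : R :=
  match n with O => 1 | S m => exp_sum x m + exp_term x n end.

Lemma IZR_S_neq0 n : IZR (Z.of_nat (S n)) <> 0.
Proof. apply not_0_IZR; lia. Qed.

Lemma is_derive_exp_term_S (n : nat) (x : R) :
  is_derive (fun y => exp_term y (S n)) x (exp_term x n).
Proof.
  induction n as [|n IH].
  - cbn [exp_term Z.of_nat Pos.of_succ_nat]. auto_derive; auto. field.
  - pose proof (IZR_S_neq0 n) as H1. pose proof (IZR_S_neq0 (S n)) as H2.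
    assert (E : IZR (Z.of_nat (S (S n))) = IZR (Z.of_nat (S n)) + 1)
      by (rewrite <- plus_IZR; f_equal; lia).
    change (is_derive (fun y => exp_term y (S n) * y / IZR (Z.of_nat (S (S n)))) x
              (exp_term x n * x / IZR (Z.of_nat (S n)))).
    change (is_derive (fun y => exp_term y (S n)) x (exp_term x n)) in IH.
    assert (F : exp_term x (S n) = exp_term x n * x / IZR (Z.of_nat (S n))) by reflexivity.
    rewrite E in *.
    set (k := IZR (Z.of_nat (S n))) in *.
    set (f := fun y => exp_term y (S n)) in *.
    apply (is_derive_ext (fun y => f y * y / (k + 1))); [reflexivity|].
    auto_derive; [eexists; exact IH|].
    replace (Derive (fun z => f z) x) with (exp_term x n)
      by (symmetry; apply is_derive_unique, IH).
    change (f x) with (exp_term x (S n)). rewrite F. field; auto.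
Qed.

Lemma is_derive_exp_sum_S (n : nat) (x : R) :
  is_derive (fun y => exp_sum y (S n)) x (exp_sum x n).
Proof.
  induction n as [|n IH].
  - cbn [exp_sum exp_term Z.of_nat Pos.of_succ_nat]. auto_derive; auto. field.
  - change (is_derive (fun y => plus (exp_sum y (S n)) (exp_term y (S (S n)))) x
              (plus (exp_sum x n) (exp_term x (S n)))).
    apply @is_derive_plus; auto. apply is_derive_exp_term_S.
Qed.

Lemma exp_term_0 n : exp_term 0 (S n) = 0.
Proof. cbn [exp_term]; unfold Rdiv; ring. Qed.

Lemma exp_sum_0 n : exp_sum 0 n = 1.
Proof. induction n as [|n IH]; cbn [exp_sum]; auto. rewrite exp_term_0, IH; ring. Qed.

(** As functions of x, the signed errors vanish at 0 and each is the derivative of the next, so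
    positivity passes from one to the next by the mean value theorem. *)
Lemma exp_sum_alternates (n : nat) (x : R) : 0 <= x ->
  0 <= (-1) ^ (S n) * (exp (- x) - exp_sum (- x) n).
Proof.
  revert x; induction n as [|n IH]; intros x Hx.
  - cbn [exp_sum pow]. assert (exp (- x) <= exp 0); [|rewrite exp_0 in *; lra].
    destruct (Req_dec x 0) as [->|]; [right; f_equal; ring|].
    left; apply exp_increasing; lra.
  - set (f := fun y => (-1) ^ S (S n) * (exp (- y) - exp_sum (- y) (S n))).
    set (df := fun y => (-1) ^ S n * (exp (- y) - exp_sum (- y) n)).
    assert (Hd : forall y, is_derive f y (df y)).
    { intros y. unfold f, df.
      pose proof (is_derive_exp_sum_S n (- y)) as H.
      set (g := fun z => exp_sum z (S n)) in *.
      apply (is_derive_ext (fun z => (-1) ^ S (S n) * (exp (- z) - g (- z))));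
        [reflexivity|].
      auto_derive; [eexists; exact H|].
      replace (Derive (fun z => g z) (- y)) with (exp_sum (- y) n)
        by (symmetry; apply is_derive_unique, H).
      cbn [pow]; ring. }
    destruct (MVT_gen f 0 x df) as [z [Hz E]].
    { intros; apply Hd. }
    { intros y _. apply continuity_pt_filterlim, (ex_derive_continuous f).
      eexists; apply Hd. }
    rewrite Rmin_left, Rmax_right in Hz by lra.
    assert (E0 : f 0 = 0).
    { unfold f. rewrite Ropp_0, exp_0, exp_sum_0; ring. }
    change (0 <= f x). specialize (IH z (proj1 Hz)).
    change (0 <= df z) in IH. rewrite E0 in E. nra.
Qed.

Lemma exp_sum_bounds (m : nat) (x : R) : 0 <= x ->
  exp_sum (- x) (S (2 * m)) <= exp (- x) <= exp_sum (- x) (2 * m).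
Proof.
  intros Hx.
  pose proof (exp_sum_alternates (2 * m) x Hx) as H1.
  pose proof (exp_sum_alternates (S (2 * m)) x Hx) as H2.
  rewrite pow_1_odd in H1.
  replace (S (S (2 * m))) with (2 * S m)%nat in H2 by lia.
  rewrite pow_1_even in H2. lra.
Qed.

(** Carries the current term along with the partial sum, so that the evaluation is linear in [n]. *)
Fixpoint iexp_terms (I : Z * Z) (n : nat) : (Z * Z) * (Z * Z) :=
  match n with
  | O => (icst 1, icst 1)
  | S m =>
      let '(T, A) := iexp_terms I m in
      let T' := imul (imul T I) (iinv (icst (Z.of_nat n))) in (T', iadd A T')
  end.

Definition iexp_sum (I : Z * Z) (n : nat) : Z * Z := snd (iexp_terms I n).

Lemma encl_exp_sum I x n : encl I x -> encl (iexp_sum I n) (exp_sum x n).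
Proof.
  intros H.
  enough (encl (fst (iexp_terms I n)) (exp_term x n) /\ encl (iexp_sum I n) (exp_sum x n))
    by tauto.
  unfold iexp_sum.
  induction n as [|n IH]; cbn [iexp_terms exp_term exp_sum].
  - split; apply encl_cst.
  - destruct (iexp_terms I n) as [T A]; cbn [fst snd] in *; destruct IH as [IH1 IH2].
    assert (HT : encl (imul (imul T I) (iinv (icst (Z.of_nat (S n)))))
                   (exp_term x n * x / IZR (Z.of_nat (S n)))).
    { apply encl_div; [|apply encl_mul; auto|apply encl_cst].
      apply Z.ltb_lt. apply Z.mul_pos_pos; [lia|reflexivity]. }
    split; auto. apply encl_add; auto.
Qed.
#[local] Hint Extern 1 (encl _ (exp_sum _ _)) => eapply encl_exp_sum; enclose : encl.

(* Antiderivative of [exp_sum (- v ^ 3) n]. *)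
Fixpoint exp_cube_sum (v : R) (n : nat) : R :=
  match n with
  | O => v
  | S m => exp_cube_sum v m + v * exp_term (- v ^ 3) n / IZR (3 * Z.of_nat n + 1)
  end.

(* Numerator and denominator of [exp_term (-27) n], enclosure of [exp_cube_sum 3 n]. *)
Fixpoint iexp_cube_sum3 (n : nat) : Z * Z * (Z * Z) :=
  match n with
  | O => (1, 1, icst 3)%Z
  | S m =>
      let '(p, q, J) := iexp_cube_sum3 m in
      let p' := (p * -27)%Z in let q' := (q * Z.of_nat n)%Z in
      let d := (q' * (3 * Z.of_nat n + 1))%Z in
      (p', q', iadd J (Z.div (3 * p' * scale) d, cdiv (3 * p' * scale) d))
  end.

(** The terms (-27) ^ n / n! reach 4 * 10 ^ 10 before they cancel; they are kept as exact fractions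
    and rounded only when added. *)
Lemma encl_exp_cube_sum3 n : encl (snd (iexp_cube_sum3 n)) (exp_cube_sum 3 n).
Proof.
  enough ((0 < snd (fst (iexp_cube_sum3 n)))%Z /\
          exp_term (-27) n = IZR (fst (fst (iexp_cube_sum3 n)))
                             / IZR (snd (fst (iexp_cube_sum3 n))) /\
          encl (snd (iexp_cube_sum3 n)) (exp_cube_sum 3 n)) by tauto.
  induction n as [|n IH]; cbn [iexp_cube_sum3 exp_term exp_cube_sum].
  - cbn [fst snd]; split; [lia|split; [field|apply encl_cst]].
  - destruct (iexp_cube_sum3 n) as [[p q] J]; cbn [fst snd] in *.
    destruct IH as [H1 [H2 H3]].
    replace (- 3 ^ 3) with (-27) by ring. rewrite H2.
    assert (0 < Z.of_nat (S n))%Z as Hn by lia.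
    assert (Hd : (0 < q * Z.of_nat (S n) * (3 * Z.of_nat (S n) + 1))%Z) by nia.
    assert (0 < IZR q) by (apply IZR_lt; auto).
    assert (0 < IZR (Z.of_nat (S n))) by (apply IZR_lt; auto).
    assert (0 < IZR (3 * Z.of_nat (S n) + 1)) by (apply IZR_lt; lia).
    split; [nia|split; [rewrite !mult_IZR; field; lra|]].
    apply encl_add; auto.
    unfold encl; cbn [fst snd].
    set (P := (3 * (p * -27) * scale)%Z).
    set (d := (q * Z.of_nat (S n) * (3 * Z.of_nat (S n) + 1))%Z) in *.
    replace (3 * (IZR p / IZR q * -27 / IZR (Z.of_nat (S n)))
              / IZR (3 * Z.of_nat (S n) + 1) * IZR scale) with (IZR P / IZR d).
    + split; [apply IZR_div_le|apply IZR_cdiv_ge]; auto.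
    + unfold P, d; rewrite !mult_IZR; field; lra.
Qed.
#[local] Hint Extern 1 (encl _ (exp_cube_sum 3 _)) => apply encl_exp_cube_sum3 : encl.

Lemma exp_term_scal (n : nat) (x : R) :
  exp_term (- x ^ 3) n = exp_term (-1) n * x ^ (3 * n).
Proof.
  induction n as [|n IH]; [cbn; ring|].
  cbn [exp_term]. rewrite IH.
  replace (3 * S n)%nat with (3 * n + 3)%nat by lia. rewrite pow_add.
  unfold Rdiv; ring.
Qed.

Lemma is_derive_exp_cube_sum (n : nat) (v : R) :
  is_derive (fun x => exp_cube_sum x n) v (exp_sum (- v ^ 3) n).
Proof.
  induction n as [|n IH].
  - cbn [exp_cube_sum exp_sum]. auto_derive; auto.
  - change (is_derive (fun x => plus (exp_cube_sum x n)
              (x * exp_term (- x ^ 3) (S n) / IZR (3 * Z.of_nat (S n) + 1))) v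
              (plus (exp_sum (- v ^ 3) n) (exp_term (- v ^ 3) (S n)))).
    apply @is_derive_plus; auto.
    assert (Hp : IZR (3 * Z.of_nat (S n) + 1) <> 0) by (apply not_0_IZR; lia).
    apply (is_derive_ext (fun x => exp_term (-1) (S n) / IZR (3 * Z.of_nat (S n) + 1)
                               * x ^ (S (3 * S n)))).
    { intros x. rewrite exp_term_scal, <- tech_pow_Rmult.
      match goal with |- ?y = ?z => change (@eq R y z) end. field; auto. }
    rewrite exp_term_scal.
    replace (IZR (3 * Z.of_nat (S n) + 1)) with (INR (S (3 * S n))) in *
      by (rewrite INR_IZR_INZ; f_equal; lia).
    generalize dependent (3 * S n)%nat. intros k Hk.
    generalize (exp_term (-1) (S n)). intros e.
    auto_derive; auto.
    change (Init.Nat.pred (S k)) with k. field; auto.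
Qed.

(** By t = v ^ 3, Gamma (1/3) is three times the limit of this function at infinity; the
    substitution removes the singularity at 0. *)
Definition cube_gauss (x : R) : R := RInt (fun v => exp (- v ^ 3)) 0 x.

Lemma continuous_exp_cube (v : R) : continuous (fun v => exp (- v ^ 3)) v.
Proof. apply @ex_derive_continuous; auto_derive; auto. Qed.

Lemma is_RInt_exp_cube (a b : R) :
  is_RInt (fun v => exp (- v ^ 3)) a b (cube_gauss b - cube_gauss a).
Proof.
  assert (H : forall c d, ex_RInt (fun v => exp (- v ^ 3)) c d).
  { intros; apply @ex_RInt_continuous; intros; apply continuous_exp_cube. }
  pose proof (RInt_correct (V := R_CompleteNormedModule) _ a b (H a b)) as HI.
  pose proof (RInt_Chasles (V := R_CompleteNormedModule) _ 0 a b (H _ _) (H _ _)) as E.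
  unfold cube_gauss. rewrite <- E.
  match goal with |- is_RInt _ _ _ ?r => replace r with (RInt (fun v => exp (- v ^ 3)) a b) end.
  - exact HI.
  - exact (eq_sym (Rplus_minus_l _ _)).
Qed.

Lemma is_derive_cube_gauss (x : R) : is_derive cube_gauss x (exp (- x ^ 3)).
Proof.
  apply (is_derive_RInt (V := R_CompleteNormedModule) (fun v => exp (- v ^ 3)) cube_gauss 0 x).
  - exists posreal_one; intros y _. apply (RInt_correct (V := R_CompleteNormedModule)).
    apply @ex_RInt_continuous; intros; apply continuous_exp_cube.
  - apply continuous_exp_cube.
Qed.

Lemma cube_gauss_incr (x y : R) : x <= y -> cube_gauss x <= cube_gauss y.
Proof.
  intros Hxy.
  pose proof (is_RInt_exp_cube x y) as H.
  assert (0 <= cube_gauss y - cube_gauss x); [|lra].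
  apply (is_RInt_le (fun _ => 0) (fun v => exp (- v ^ 3)) x y); auto.
  - evar_last; [apply (is_RInt_const x y 0)|]. unfold scal; simpl; unfold mult; simpl; ring.
  - intros; left; apply exp_pos.
Qed.

(** The alternating bounds for exp (- v ^ 3) are integrated over [0, 3]. They nearly coincide, as 27
    ^ 101 / 101! < 10 ^ (-15). *)
Lemma cube_gauss_3 :
  exp_cube_sum 3 101 <= cube_gauss 3 <= exp_cube_sum 3 100.
Proof.
  assert (Hi : forall n, is_RInt (fun v => exp_sum (- v ^ 3) n) 0 3 (exp_cube_sum 3 n)).
  { intros n. evar_last.
    - apply (is_RInt_derive (fun x => exp_cube_sum x n)).
      + intros; apply is_derive_exp_cube_sum.
      + intros x _.
        assert (Hc : continuous (fun y => exp_sum y n) (- x ^ 3)).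
        { destruct n as [|n]; [apply continuous_const|].
          apply @ex_derive_continuous. eexists; apply is_derive_exp_sum_S. }
        apply (continuous_comp (fun v => - v ^ 3) (fun y => exp_sum y n)); auto.
        apply @ex_derive_continuous; auto_derive; auto.
    - unfold minus, plus, opp; simpl.
      assert (E : exp_cube_sum 0 n = 0).
      { clear; induction n as [|n IH]; cbn [exp_cube_sum]; auto. rewrite IH. unfold Rdiv; ring. }
      rewrite E; ring. }
  assert (HI : is_RInt (fun v => exp (- v ^ 3)) 0 3 (cube_gauss 3)).
  { evar_last; [apply is_RInt_exp_cube|]. unfold cube_gauss at 2.
    rewrite RInt_point. unfold zero; simpl; ring. }
  assert (Hb : forall v, 0 < v < 3 ->
     exp_sum (- v ^ 3) 101 <= exp (- v ^ 3) <= exp_sum (- v ^ 3) 100).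
  { intros v Hv. apply (exp_sum_bounds 50). apply pow_le; lra. }
  split.
  - refine (is_RInt_le _ _ 0 3 _ _ _ (Hi 101%nat) HI _); [lra|intros; apply Hb; auto].
  - refine (is_RInt_le _ _ 0 3 _ _ _ HI (Hi 100%nat) _); [lra|intros; apply Hb; auto].
Qed.

Lemma exp_mult_nat (n : nat) (x : R) : exp (INR n * x) = exp x ^ n.
Proof.
  induction n as [|n IH]; [cbn; rewrite Rmult_0_l; apply exp_0|].
  rewrite S_INR, Rmult_plus_distr_r, exp_plus, IH, Rmult_1_l. cbn; ring.
Qed.

(** Beyond 3 the integrand is at most v ^ 2 / 9 times itself, which has an elementary
    antiderivative. *)
Lemma cube_gauss_tail (x : R) : 3 <= x -> cube_gauss x <= cube_gauss 3 + exp (- 27) / 27.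
Proof.
  intros Hx.
  assert (Hd : is_RInt (fun v => v ^ 2 / 9 * exp (- v ^ 3)) 3 x
            (minus (- exp (- x ^ 3) / 27) (- exp (- 3 ^ 3) / 27))).
  { apply (is_RInt_derive (fun v => - exp (- v ^ 3) / 27)).
    - intros v _. auto_derive; auto. cbn; field.
    - intros v _. apply @ex_derive_continuous; auto_derive; auto. }
  assert (H : cube_gauss x - cube_gauss 3
              <= minus (- exp (- x ^ 3) / 27) (- exp (- 3 ^ 3) / 27)).
  { refine (is_RInt_le _ _ 3 x _ _ _ (is_RInt_exp_cube 3 x) Hd _); auto.
    intros v Hv. pose proof (exp_pos (- v ^ 3)). assert (1 <= v ^ 2 / 9) by nra. nra. }
  unfold minus, plus, opp in H; simpl in H.
  replace (- (3 * (3 * (3 * 1)))) with (- 27) in H by ring.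
  pose proof (exp_pos (- (x * (x * (x * 1))))). lra.
Qed.

(** [L] is the limit of [cube_gauss], which is increasing and bounded by the tail estimate; the
    improper integral at both ends is then checked against the definition of its filters. *)
Lemma Gamma_third : exists L : R,
  Gamma (1 / 3) = 3 * L /\ cube_gauss 3 <= L <= cube_gauss 3 + exp (- 27) / 27.
Proof.
  destruct (ex_finite_lim_seq_incr (fun n => cube_gauss (INR n))
              (cube_gauss 3 + exp (- 27) / 27)) as [L HL].
  { intros n; apply cube_gauss_incr; rewrite S_INR; lra. }
  { intros n. destruct (Rle_lt_dec 3 (INR n)) as [H|H].
    - apply cube_gauss_tail; auto.
    - pose proof (cube_gauss_incr (INR n) 3). pose proof (exp_pos (-27)). lra. }
  assert (Hlow : forall x, cube_gauss x <= L).
  { intros x. destruct (nfloor_ex (Rmax x 0)) as [n Hn]; [apply Rmax_r|].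
    apply Rle_trans with (cube_gauss (INR (S n))).
    { apply cube_gauss_incr. pose proof (Rmax_l x 0). rewrite S_INR; lra. }
    apply (is_lim_seq_incr_compare _ _ HL).
    intros m; apply cube_gauss_incr; rewrite S_INR; lra. }
  exists L. split; [|split].
  - unfold Gamma. apply is_RInt_gen_unique.
    (* Antiderivative of the Gamma integrand on the positive reals, from t = v ^ 3. *)
    set (G := fun x => 3 * cube_gauss (Rpower x (1 / 3))).
    assert (HG : forall x, 0 < x ->
              is_derive G x (Rpower x (1 / 3 - 1) * exp (- x))).
    { intros x Hx. unfold G.
      assert (HR : is_derive (fun y => Rpower y (1 / 3)) x (1 / 3 * Rpower x (1 / 3 - 1))).
      { apply is_derive_Reals. apply derivable_pt_lim_power; auto. }
      evar_last.
      { apply is_derive_scal. apply (is_derive_comp cube_gauss); [|exact HR].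
        apply is_derive_cube_gauss. }
      unfold scal; simpl; unfold mult; simpl.
      replace (Rpower x (1 / 3) * (Rpower x (1 / 3) * (Rpower x (1 / 3) * 1))) with x.
      { field. }
      rewrite Rmult_1_r, <- !Rpower_plus.
      replace (1 / 3 + (1 / 3 + 1 / 3)) with 1 by field. symmetry; apply Rpower_1; auto. }
    assert (HI : forall x y, 0 < x -> 0 < y ->
       is_RInt (fun t => Rpower t (1 / 3 - 1) * exp (- t)) x y (G y - G x)).
    { intros x y Hx Hy. apply (is_RInt_derive G).
      - intros z Hz. apply HG. pose proof (Rmin_glb_lt x y 0 Hx Hy). lra.
      - intros z Hz. assert (0 < z) by (pose proof (Rmin_glb_lt x y 0 Hx Hy); lra).
        apply @ex_derive_continuous. unfold Rpower. auto_derive; auto. }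
    intros P [eps HP].
    (* Each of the two ends may cost eps / 6, since [G] carries a factor 3. *)
    assert (Hcv : exists M, 0 < M /\ forall y, M < y -> L - eps / 6 < cube_gauss y).
    { destruct (HL (fun z => L - eps / 6 < z)) as [N HN].
      { exists (mkposreal (eps / 6) ltac:(pose proof (cond_pos eps); lra)).
        intros z Hz. apply Rabs_lt_between' in Hz. cbn in Hz. lra. }
      exists (INR N + 1). split; [pose proof (pos_INR N); lra|].
      intros y Hy. eapply Rlt_le_trans; [apply (HN N); auto|].
      apply cube_gauss_incr; lra. }
    destruct Hcv as [M [HM Hcv]].
    assert (Hc0 : forall x, 0 <= x -> 0 <= cube_gauss x <= x).
    { intros x Hx. pose proof (is_RInt_exp_cube 0 x) as H.
      assert (E : cube_gauss 0 = 0) by exact (RInt_point (V := R_CompleteNormedModule) 0 _).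
      rewrite E, Rminus_0_r in H. split.
      - rewrite <- E; apply cube_gauss_incr; auto.
      - refine (is_RInt_le _ (fun _ => 1) 0 x _ x Hx H _ _).
        + evar_last; [apply (is_RInt_const 0 x 1)|]. unfold scal; simpl; unfold mult; simpl; ring.
        + intros v Hv. rewrite <- exp_0. left; apply exp_increasing.
          assert (0 < v ^ 3) by (apply pow_lt; lra). lra. }
    set (e := eps / 6). assert (He : 0 < e) by (unfold e; pose proof (cond_pos eps); lra).
    apply (Filter_prod _ _ _ (fun x => 0 < x < e ^ 3) (fun y => M ^ 3 < y)).
    + exists (mkposreal (e ^ 3) (pow_lt _ 3 He)). intros x Hx Hx0.
      apply Rabs_lt_between' in Hx. cbn in Hx. cbn. lra.
    + exists (M ^ 3); auto.
    + intros x y [Hx0 Hx] Hy. cbn [fst snd].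
      assert (HM3 : 0 < M ^ 3) by (apply pow_lt; auto).
      exists (G y - G x). split; [apply HI; lra|].
      apply HP. apply Rabs_lt_between'. unfold G.
      assert (Hpow : forall z, 0 < z -> Rpower (z ^ 3) (1 / 3) = z).
      { intros z Hz. replace (z ^ 3) with (Rpower z 3).
        - rewrite Rpower_mult. replace (3 * (1 / 3)) with 1 by field. apply Rpower_1; auto.
        - replace 3 with (INR 3) by (cbn; ring). apply Rpower_pow; auto. }
      assert (Hy' : M < Rpower y (1 / 3)).
      { rewrite <- (Hpow M HM). apply Rlt_Rpower_l; lra. }
      assert (Hx' : Rpower x (1 / 3) < e).
      { rewrite <- (Hpow e He). apply Rlt_Rpower_l; lra. }
      assert (Hx'' : 0 < Rpower x (1 / 3)) by apply exp_pos.
      specialize (Hcv _ Hy'). specialize (Hlow (Rpower y (1 / 3))).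
      destruct (Hc0 (Rpower x (1 / 3))) as [? ?]; [lra|].
      unfold e in *. lra.
  - apply Hlow.
  - apply (is_lim_seq_le (fun n => cube_gauss (INR n))
      (fun _ => cube_gauss 3 + exp (- 27) / 27) L (cube_gauss 3 + exp (- 27) / 27)); auto.
    + intros n. destruct (Rle_lt_dec 3 (INR n)) as [H|H].
      * apply cube_gauss_tail; auto.
      * pose proof (cube_gauss_incr (INR n) 3). pose proof (exp_pos (-27)). lra.
    + apply is_lim_seq_const.
Qed.

Lemma encl_Gamma_third :
  encl (26789385347070000000000000, 26789385347090000000000000)%Z (Gamma (1 / 3)).
Proof.
  destruct Gamma_third as [L [-> [H1 H2]]].
  destruct cube_gauss_3 as [H3 H4].
  (* exp (- 27) is the 27th power of exp (- 1), which the Taylor sum of degree 4 bounds by 3 / 8 <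
     19 / 50. *)
  assert (He : exp (- 27) <= (19 / 50) ^ 27).
  { replace (- 27) with (INR 27 * - (1)) by (rewrite INR_IZR_INZ; cbn; ring).
    rewrite exp_mult_nat. apply pow_incr. split; [left; apply exp_pos|].
    eapply Rle_trans; [apply (exp_sum_bounds 2); lra|]. enclose_cmp. }
  assert (A1 : 26789385347070 / 30000000000000 <= L).
  { eapply Rle_trans; [|eapply Rle_trans; [apply H3|apply H1]]. enclose_cmp. }
  assert (A2 : L <= 26789385347090 / 30000000000000).
  { eapply Rle_trans; [apply H2|].
    apply Rle_trans with (exp_cube_sum 3 100 + (19 / 50) ^ 27 / 27); [lra|]. enclose_cmp. }
  unfold encl, scale; cbn [fst snd]; split; lra.
Qed.

Definition iexp_neg (m : nat) (I : Z * Z) : Z * Z :=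
  (fst (iexp_sum (iopp I) (S (2 * m))), snd (iexp_sum (iopp I) (2 * m))).

Lemma encl_exp_neg m I x : Z.leb 0 (fst I) = true -> encl I x ->
  encl (iexp_neg m I) (exp (- x)).
Proof.
  rewrite Z.leb_le. intros H0 H.
  assert (Hx : 0 <= x).
  { apply IZR_le in H0. pose proof scale_pos. destruct H. nra. }
  pose proof (exp_sum_bounds m x Hx) as Hb.
  pose proof (encl_exp_sum _ _ (S (2 * m)) (encl_opp _ _ H)) as H3.
  pose proof (encl_exp_sum _ _ (2 * m) (encl_opp _ _ H)) as H4.
  unfold iexp_neg. revert Hb H3 H4.
  generalize (iexp_sum (iopp I) (S (2 * m))) (iexp_sum (iopp I) (2 * m))
    (exp_sum (- x) (S (2 * m))) (exp_sum (- x) (2 * m)).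
  intros A B y z Hb [H3 _] [_ H4]. pose proof scale_pos as Hs.
  split; cbn [fst snd]; nra.
Qed.

Lemma encl_exp m I x : Z.leb 0 (fst I) = true -> Z.ltb 0 (fst (iexp_neg m I)) = true ->
  encl I x -> encl (iinv (iexp_neg m I)) (exp x).
Proof.
  intros H1 H2 H. replace (exp x) with (/ exp (- x)) by (rewrite exp_Ropp, Rinv_inv; auto).
  apply encl_inv; auto. apply encl_exp_neg; auto.
Qed.
(* Taylor sums of degrees 8 and 9 are precise enough here: the exponents that reach this hint are at
   most 3 / 2. *)
#[local] Hint Extern 2 (encl _ (exp _)) =>
  eapply (encl_exp 4); [| |enclose]; [vm_compute; reflexivity|vm_compute; reflexivity] : encl.

(* With rho = 1/2 + i sqrt 3 / 2: [height] = 2 pi Im rho, nome rho = - [c], and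
   s = (tau - rho) / (tau - conj rho) = - b w / (1 - b w) for w = 2 pi i (tau - rho). *)
Definition height : R := PI * sqrt 3.
(** The exponential series is summed at height / 6 < 1 and not at height. Besides, [t6 ^ 2] is the
    cube root of [c] that enters [j_eq]. *)
Definition t6 : R := exp (- (height / 6)).
Definition c : R := exp (- height).
Definition b : R := / (2 * height).

Lemma encl_height :
  encl (54413980927026534000000000, 54413980927026537000000000)%Z height.
Proof. unfold height. enclose_cmp. Qed.
#[local] Hint Resolve encl_height : encl.

Lemma encl_t6 : encl (4037741136100485000000000, 4037741136100488000000000)%Z t6.
Proof.
  unfold t6. eapply encl_weaken.
  - eapply (encl_exp_neg 12); [|enclose]; vm_compute; reflexivity.
  - vm_compute; reflexivity.
Qed.
#[local] Hint Resolve encl_t6 : encl.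

Lemma c_t6 : c = t6 ^ 6.
Proof.
  unfold c, t6. rewrite <- exp_mult_nat. f_equal. INR_literal. field.
Qed.

Lemma encl_c : encl (43334205099831200000000, 43334205099831400000000)%Z c.
Proof. rewrite c_t6. enclose_cmp. Qed.
#[local] Hint Resolve encl_c : encl.

Lemma encl_b : encl (918881492369653000000000, 918881492369654000000000)%Z b.
Proof. unfold b. enclose_cmp. Qed.
#[local] Hint Resolve encl_Gamma_third encl_b : encl.

(** * The complex exponential *)

Lemma RtoC_neq (x y : R) : x <> y -> RtoC x <> RtoC y.
Proof. intros H E; apply H; injection E; auto. Qed.

Lemma Cexp_0 : Cexp 0 = 1%C.
Proof. unfold Cexp, RtoC; cbn. rewrite exp_0, cos_0, sin_0. f_equal; ring. Qed.

Lemma Cexp_plus (z w : C) : Cexp (z + w) = (Cexp z * Cexp w)%C.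
Proof.
  destruct z as [x y], w as [x' y']; unfold Cexp, Cmult, Cplus; cbn.
  rewrite exp_plus, cos_plus, sin_plus; f_equal; ring.
Qed.

Lemma Cexp_pow (n : nat) (z : C) : Cexp (INR n * z) = (Cexp z ^ n)%C.
Proof.
  induction n as [|n IH].
  - replace (INR 0 * z)%C with (RtoC 0) by (cbn; ring). apply Cexp_0.
  - rewrite S_INR, RtoC_plus, Cmult_plus_distr_r, Cexp_plus, IH, Cmult_1_l. cbn; ring.
Qed.

Lemma Cmod_Cexp (z : C) : Cmod (Cexp z) = exp (Re z).
Proof.
  unfold Cmod, Cexp; cbn [fst snd].
  replace ((exp (Re z) * cos (Im z)) ^ 2 + (exp (Re z) * sin (Im z)) ^ 2)
    with (Rsqr (exp (Re z))).
  - apply sqrt_Rsqr; left; apply exp_pos.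
  - pose proof (sin2_cos2 (Im z)) as H. unfold Rsqr in *.
    transitivity (exp (Re z) * exp (Re z) * (sin (Im z) * sin (Im z) + cos (Im z) * cos (Im z)));
      [rewrite H|]; ring.
Qed.

Lemma Cexp_neq0 (z : C) : Cexp z <> 0.
Proof. apply Cmod_gt_0; rewrite Cmod_Cexp; apply exp_pos. Qed.

Lemma Re_le_Cmod (z : C) : Re z <= Cmod z.
Proof. pose proof (re_le_Cmod z); pose proof (Rle_abs (Re z)); lra. Qed.

Lemma exp_le (x y : R) : x <= y -> exp x <= exp y.
Proof.
  intros [H|H]; [left; apply exp_increasing; auto|right; f_equal; auto].
Qed.

Lemma Cmod_Cexp_le (z : C) : Cmod (Cexp z) <= exp (Cmod z).
Proof. rewrite Cmod_Cexp; apply exp_le, Re_le_Cmod. Qed.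

(** Complex functions are differentiated only along segments, hence the real parameter. *)
Definition is_cderive (f : R -> C) (s : R) (l : C) : Prop :=
  is_derive (fun x => Re (f x)) s (Re l) /\ is_derive (fun x => Im (f x)) s (Im l).

Lemma is_cderive_plus f g s l m : is_cderive f s l -> is_cderive g s m ->
  is_cderive (fun x => f x + g x)%C s (l + m)%C.
Proof.
  intros [H1 H2] [H3 H4]; split.
  - exact (is_derive_plus _ _ _ _ _ H1 H3).
  - exact (is_derive_plus _ _ _ _ _ H2 H4).
Qed.

Lemma is_cderive_opp f s l : is_cderive f s l -> is_cderive (fun x => - f x)%C s (- l)%C.
Proof. intros [H1 H2]; split; [exact (is_derive_opp _ _ _ H1)|exact (is_derive_opp _ _ _ H2)]. Qed.

Lemma is_derive_mult_const (f : R -> R) (k s l : R) : is_derive f s l ->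
  is_derive (fun x => f x * k) s (l * k).
Proof.
  intros H. auto_derive; [eexists; exact H|].
  replace (Derive (fun x => f x) s) with l by (symmetry; apply is_derive_unique, H). ring.
Qed.

Lemma is_cderive_real (f : R -> R) (z : C) s l : is_derive f s l ->
  is_cderive (fun x => f x * z)%C s (l * z)%C.
Proof.
  intros H; split.
  - replace (Re (l * z)) with (l * Re z) by (unfold Re; cbn; ring).
    apply (is_derive_ext (fun x => f x * Re z)); [|apply is_derive_mult_const, H].
    intros x; unfold Re; cbn. match goal with |- ?y = ?z => change (@eq R y z) end. ring.
  - replace (Im (l * z)) with (l * Im z) by (unfold Im; cbn; ring).
    apply (is_derive_ext (fun x => f x * Im z)); [|apply is_derive_mult_const, H].
    intros x; unfold Im; cbn. match goal with |- ?y = ?z => change (@eq R y z) end. ring.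
Qed.

Lemma is_cderive_const (z : C) s : is_cderive (fun _ => z) s 0.
Proof. split; [exact (is_derive_const (Re z) s)|exact (is_derive_const (Im z) s)]. Qed.

Lemma is_cderive_Cexp (p z : C) (s : R) :
  is_cderive (fun x => Cexp (p + x * z)) s (z * Cexp (p + s * z))%C.
Proof.
  destruct p as [p1 p2], z as [x y].
  split; unfold Cexp, Cmult, Cplus, RtoC, Re, Im; cbn [fst snd]; auto_derive; auto;
    unfold Rminus; ring.
Qed.

Lemma curve_increment_le (f df : R -> C) (g dg : R -> R) (s : R) : 0 <= s ->
  (forall x, is_cderive f x (df x)) -> (forall x, is_derive g x (dg x)) ->
  (forall x, 0 <= x <= s -> Cmod (df x) <= dg x) ->
  Cmod (f s - f 0)%C <= g s - g 0.
Proof.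
  intros Hs Hf Hg Hle.
  (* Mean value theorem for the projection of the curve on the direction of its increment. *)
  remember (f s - f 0)%C as d eqn:Ed.
  set (h := fun x => Re d * Re (f x) + Im d * Im (f x) - Cmod d * g x).
  set (dh := fun x => Re d * Re (df x) + Im d * Im (df x) - Cmod d * dg x).
  assert (Hh : forall x, is_derive h x (dh x)).
  { intros x. destruct (Hf x) as [H1 H2]. specialize (Hg x).
    set (f1 := fun x0 => Re (f x0)) in *. set (f2 := fun x0 => Im (f x0)) in *.
    apply (is_derive_ext (fun x => Re d * f1 x + Im d * f2 x - Cmod d * g x)); [reflexivity|].
    auto_derive; [repeat split; eexists; eassumption|].
    replace (Derive (fun y => f1 y) x) with (Re (df x)) by (symmetry; apply is_derive_unique, H1).
    replace (Derive (fun y => f2 y) x) with (Im (df x)) by (symmetry; apply is_derive_unique, H2).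
    replace (Derive (fun y => g y) x) with (dg x) by (symmetry; apply is_derive_unique, Hg).
    unfold dh; ring. }
  destruct (MVT_gen h 0 s dh) as [x [Hx E]].
  { intros; apply Hh. }
  { intros y _. apply continuity_pt_filterlim, (ex_derive_continuous h). eexists; apply Hh. }
  rewrite Rmin_left, Rmax_right in Hx by auto.
  assert (Hdh : dh x <= 0).
  { unfold dh. specialize (Hle x Hx).
    pose proof (Cmod_ge_0 d).
    assert (Re d * Re (df x) + Im d * Im (df x) <= Cmod d * Cmod (df x)).
    { replace (Re d * Re (df x) + Im d * Im (df x)) with (Re (Cconj d * df x))
        by (unfold Cconj, Cmult, Re, Im; cbn; ring).
      eapply Rle_trans; [apply Re_le_Cmod|]. rewrite Cmod_mult, Cmod_conj; lra. }
    nra. }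
  assert (Hd : Cmod d * Cmod d <= Cmod d * (g s - g 0)).
  { assert (E2 : Cmod d * Cmod d = Re d * Re d + Im d * Im d).
    { replace (Cmod d * Cmod d) with (Cmod d ^ 2) by ring. rewrite Cmod2_alt; ring. }
    assert (h s - h 0 <= 0) by (rewrite E; nra).
    unfold h in H.
    assert (E3 : Re d = Re (f s) - Re (f 0)) by (rewrite Ed; reflexivity).
    assert (E4 : Im d = Im (f s) - Im (f 0)) by (rewrite Ed; reflexivity).
    replace (Cmod d * Cmod d) with (Re d * (Re (f s) - Re (f 0)) + Im d * (Im (f s) - Im (f 0))).
    - lra.
    - rewrite E2, <- E3, <- E4; ring. }
  (* A zero increment cannot be divided out; [g s] is then at least [g 0] because its derivative
     dominates a modulus. *)
  destruct (Req_dec (Cmod d) 0) as [H0|H0].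
  - assert (Hg0 : g 0 <= g s).
    { destruct (MVT_gen g 0 s dg) as [y [Hy E3]].
      { intros; apply Hg. }
      { intros y _. apply continuity_pt_filterlim, (ex_derive_continuous g). eexists; apply Hg. }
      rewrite Rmin_left, Rmax_right in Hy by auto.
      specialize (Hle y Hy). pose proof (Cmod_ge_0 (df y)). nra. }
    lra.
  - pose proof (Cmod_ge_0 d). apply Rmult_le_reg_l with (Cmod d); lra.
Qed.

(** Taylor sum of exp (s z) as a curve in the real variable s: differentiation in s multiplies by z
    and lowers [n]. *)
Fixpoint Cexp_sum (s : R) (z : C) (n : nat) : C :=
  match n with O => 1 | S m => Cexp_sum s z m + exp_term s n * z ^ n end%C.

Lemma Cexp_sum_0 (z : C) (n : nat) : Cexp_sum 0 z n = 1.
Proof.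
  induction n as [|n IH]; cbn [Cexp_sum]; auto. rewrite IH, exp_term_0; ring.
Qed.

Lemma is_cderive_Cexp_sum (z : C) (n : nat) (s : R) :
  is_cderive (fun x => Cexp_sum x z (S n)) s (z * Cexp_sum s z n)%C.
Proof.
  induction n as [|n IH].
  - replace (z * Cexp_sum s z 0)%C with (0 + exp_term s 0 * z ^ 1)%C by (cbn; ring).
    apply (is_cderive_plus (fun _ => Cexp_sum 0 z 0)).
    + apply is_cderive_const.
    + apply is_cderive_real, is_derive_exp_term_S.
  - replace (z * Cexp_sum s z (S n))%C
      with (z * Cexp_sum s z n + exp_term s (S n) * z ^ S (S n))%C by (cbn [Cexp_sum Cpow]; ring).
    apply (is_cderive_plus (fun x => Cexp_sum x z (S n))); auto.
    apply is_cderive_real, is_derive_exp_term_S.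
Qed.

Lemma exp_term_nonneg (x : R) (n : nat) : 0 <= x -> 0 <= exp_term x n.
Proof.
  intros Hx; induction n as [|n IH]; cbn [exp_term]; [lra|].
  apply Rmult_le_pos; [nra|]. left; apply Rinv_0_lt_compat, IZR_lt; lia.
Qed.

(** Along the curve in s, the remainder of order n + 1 has derivative z times that of order n, and
    the bound integrates in the same way because [exp_term] does. *)
Lemma Cexp_sum_remainder (z : C) (n : nat) (s : R) : 0 <= s <= 1 ->
  Cmod (Cexp (s * z) - Cexp_sum s z n)%C
    <= exp (Cmod z) * Cmod z ^ S n * exp_term s (S n).
Proof.
  revert s; induction n as [|n IH]; intros s Hs.
  - pose proof (curve_increment_le
      (fun x => Cexp (0 + x * z)) (fun x => z * Cexp (0 + x * z))%C
      (fun x => exp (Cmod z) * Cmod z * x) (fun x => exp (Cmod z) * Cmod z) s) as H.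
    cbn [exp_term Cexp_sum Z.of_nat Pos.of_succ_nat]. cbv beta in H.
    replace (0 + 0 * z)%C with (RtoC 0) in H by ring.
    rewrite Cplus_0_l, Cexp_0 in H.
    replace (exp (Cmod z) * Cmod z ^ 1 * (1 * s / 1))
      with (exp (Cmod z) * Cmod z * s - exp (Cmod z) * Cmod z * 0) by field.
    apply H; [lra|apply is_cderive_Cexp| |].
    + intros x; auto_derive; auto; ring.
    + intros x Hx. rewrite Cplus_0_l, Cmod_mult.
      rewrite Rmult_comm. apply Rmult_le_compat_r; [apply Cmod_ge_0|].
      eapply Rle_trans; [apply Cmod_Cexp_le|]. apply exp_le.
      rewrite Cmod_mult, Cmod_R, Rabs_right by lra. pose proof (Cmod_ge_0 z). nra.
  - set (M := exp (Cmod z) * Cmod z ^ S n) in *.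
    assert (HM : 0 <= M).
    { apply Rmult_le_pos; [left; apply exp_pos|apply pow_le, Cmod_ge_0]. }
    pose proof (curve_increment_le
      (fun x => Cexp (0 + x * z) + - Cexp_sum x z (S n))%C
      (fun x => z * Cexp (0 + x * z) + - (z * Cexp_sum x z n))%C
      (fun x => M * Cmod z * exp_term x (S (S n)))
      (fun x => M * Cmod z * exp_term x (S n)) s) as H.
    cbv beta in H. rewrite Cexp_sum_0, exp_term_0 in H.
    replace (0 + 0 * z)%C with (RtoC 0) in H by ring.
    rewrite Cplus_0_l, Cexp_0 in H.
    replace (exp (Cmod z) * Cmod z ^ S (S n) * exp_term s (S (S n)))
      with (M * Cmod z * exp_term s (S (S n)) - M * Cmod z * 0)
      by (unfold M; cbn [pow]; ring).
    replace (Cexp (s * z) - Cexp_sum s z (S n))%C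
      with (Cexp (s * z) + - Cexp_sum s z (S n) - (1 + - (1)))%C by ring.
    apply H; [lra| | |].
    + intros x. apply is_cderive_plus; [apply is_cderive_Cexp|].
      apply is_cderive_opp, is_cderive_Cexp_sum.
    + intros x. evar_last; [apply is_derive_scal, is_derive_exp_term_S|].
      reflexivity.
    + intros x Hx. specialize (IH x ltac:(lra)).
      replace (z * Cexp (0 + x * z) + - (z * Cexp_sum x z n))%C
        with (z * (Cexp (x * z) - Cexp_sum x z n))%C
        by (rewrite Cplus_0_l; ring).
      rewrite Cmod_mult. pose proof (Cmod_ge_0 z).
      pose proof (exp_term_nonneg x (S n) ltac:(lra)). nra.
Qed.

Fixpoint cpoly (l : list R) (w : C) : C :=
  match l with nil => RtoC 0 | x :: l' => x + w * cpoly l' w end%C.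
Fixpoint rpoly (l : list R) (r : R) : R :=
  match l with nil => 0 | x :: l' => x + r * rpoly l' r end.

Lemma Cmod_cpoly_le (l m : list R) (w : C) (r : R) : Cmod w <= r ->
  Forall2 (fun x y => Rabs x <= y) l m -> Cmod (cpoly l w) <= rpoly m r.
Proof.
  intros Hr H; induction H as [|x y l m Hxy _ IH]; cbn [cpoly rpoly].
  - rewrite Cmod_0; lra.
  - eapply Rle_trans; [apply Cmod_triangle|]. rewrite Cmod_R, Cmod_mult.
    pose proof (Cmod_ge_0 w). pose proof (Cmod_ge_0 (cpoly l w)). nra.
Qed.

Definition taylor6 (m : nat -> R) : list R :=
  [m 0%nat; m 1%nat; m 2%nat / 2; m 3%nat / 6; m 4%nat / 24; m 5%nat / 120].

Lemma Cexp_taylor6 (x : R) (w : C) :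
  Cmod (Cexp (x * w) - cpoly (taylor6 (fun k => (x ^ k)%R)) w)%C
    <= exp (Rabs x * Cmod w) * (Rabs x * Cmod w) ^ 6 / 720.
Proof.
  pose proof (Cexp_sum_remainder (x * w)%C 5 1 ltac:(lra)) as H.
  rewrite Cmult_1_l, Cmod_mult, Cmod_R in H.
  replace (exp_term 1 6) with (/ 720) in H by (cbn; field).
  replace (Cexp_sum 1 (x * w) 5) with (cpoly (taylor6 (fun k => (x ^ k)%R)) w) in H; [exact H|].
  cbn [Cexp_sum taylor6 cpoly exp_term Z.of_nat Pos.of_succ_nat Pos.succ].
  unfold Rdiv. rewrite !RtoC_mult, !RtoC_pow, !RtoC_inv by lra. field.
Qed.

Fixpoint expsum (l : list (R * R)) (w : C) : C :=
  match l with nil => RtoC 0 | (u, x) :: l' => u * Cexp (x * w) + expsum l' w end%C.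
(** The k-th derivative of [expsum l] at 0. *)
Fixpoint moment (l : list (R * R)) (k : nat) : R :=
  match l with nil => 0 | (u, x) :: l' => u * x ^ k + moment l' k end.
Fixpoint expsum_rem (l : list (R * R)) (r : R) : R :=
  match l with
  | nil => 0
  | (u, x) :: l' => Rabs u * (exp (Rabs x * r) * (Rabs x * r) ^ 6 / 720) + expsum_rem l' r
  end.

Lemma expsum_taylor6 (l : list (R * R)) (w : C) (r : R) : Cmod w <= r ->
  Cmod (expsum l w - cpoly (taylor6 (moment l)) w)%C <= expsum_rem l r.
Proof.
  intros Hr; induction l as [|[u x] l IH]; cbn [expsum expsum_rem].
  - replace (0 - cpoly (taylor6 (moment nil)) w)%C with (RtoC 0).
    + rewrite Cmod_0; lra.
    + cbn. unfold Rdiv; rewrite !Rmult_0_l. ring.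
  - replace (u * Cexp (x * w) + expsum l w - cpoly (taylor6 (moment ((u, x) :: l))) w)%C
      with (u * (Cexp (x * w) - cpoly (taylor6 (fun k => (x ^ k)%R)) w)
            + (expsum l w - cpoly (taylor6 (moment l)) w))%C.
    + eapply Rle_trans; [apply Cmod_triangle|]. apply Rplus_le_compat; auto.
      rewrite Cmod_mult, Cmod_R. apply Rmult_le_compat_l; [apply Rabs_pos|].
      eapply Rle_trans; [apply Cexp_taylor6|].
      pose proof (Cmod_ge_0 w). pose proof (Rabs_pos x).
      assert (Rabs x * Cmod w <= Rabs x * r) by nra.
      apply Rmult_le_compat_r; [lra|].
      apply Rmult_le_compat; [left; apply exp_pos|apply pow_le; nra|apply exp_le; auto|].
      apply pow_incr; split; [nra|auto].
    + cbn [taylor6 moment cpoly]. unfold Rdiv.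
      rewrite !RtoC_mult, !RtoC_plus, !RtoC_mult. ring.
Qed.

(** * The q-series *)

Definition is_Clim (u : nat -> C) (l : C) : Prop :=
  forall eps, 0 < eps -> exists N, forall n, (N <= n)%nat -> Cmod (u n - l)%C < eps.

Lemma is_Clim_filterlim (u : nat -> C) (l : C) : is_Clim u l <->
  filterlim u eventually (locally (l : C_NormedModule)).
Proof.
  split; intros H.
  - intros P HP.
    destruct (locally_norm_le_locally (V := C_NormedModule) l P) as [eps He].
    { exact HP. }
    destruct (H eps (cond_pos eps)) as [N HN].
    exists N; intros n Hn. apply He. exact (HN n Hn).
  - intros eps He.
    destruct (H (fun z => Cmod (z - l)%C < eps)) as [N HN].
    { apply (locally_le_locally_norm (V := C_NormedModule) l).
      exists (mkposreal eps He). intros z Hz. exact Hz. }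
    exists N; exact HN.
Qed.

Lemma Clim_seq_unique (u : nat -> C) (l : C) : is_Clim u l -> Clim_seq u = l.
Proof.
  intros H. apply is_Clim_filterlim in H.
  exact (iota_filterlim_locally (V := C_CompleteNormedModule) u l H).
Qed.

Lemma CSeries_unique (a : nat -> C) (l : C) :
  is_Clim (sum_n (G := C_AbelianMonoid) a) l -> CSeries a = l.
Proof.
  intros H. apply is_Clim_filterlim in H.
  exact (iota_filterlim_locally (V := C_CompleteNormedModule) _ l H).
Qed.

Lemma is_Clim_ext (u v : nat -> C) (l : C) : (forall n, u n = v n) -> is_Clim u l -> is_Clim v l.
Proof.
  intros E H eps He. destruct (H eps He) as [N HN]. exists N; intros n Hn.
  rewrite <- E; auto.
Qed.

Lemma is_Clim_S (u : nat -> C) (l : C) : is_Clim (fun n => u (S n)) l -> is_Clim u l.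
Proof.
  intros H eps He. destruct (H eps He) as [N HN]. exists (S N); intros [|n] Hn; [lia|].
  apply HN; lia.
Qed.

Lemma is_Clim_Cmod_le (u v : nat -> C) (l l' c : C) (m : nat) (B : R) :
  is_Clim u l -> is_Clim v l' ->
  (forall n, (m <= n)%nat -> Cmod (u n - v n - c)%C <= B) -> Cmod (l - l' - c)%C <= B.
Proof.
  intros Hu Hv H. apply le_epsilon. intros eps He.
  destruct (Hu (eps / 2)) as [N1 H1]; [lra|]. destruct (Hv (eps / 2)) as [N2 H2]; [lra|].
  set (n := (m + N1 + N2)%nat).
  specialize (H n ltac:(unfold n; lia)). specialize (H1 n ltac:(unfold n; lia)).
  specialize (H2 n ltac:(unfold n; lia)).
  replace (l - l' - c)%C with ((u n - v n - c) + (- (u n - l) + (v n - l')))%C by ring.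
  pose proof (Cmod_triangle (u n - v n - c) (- (u n - l) + (v n - l'))).
  pose proof (Cmod_triangle (- (u n - l)) (v n - l')). rewrite Cmod_opp in *. lra.
Qed.

Lemma is_Clim_const (c : C) : is_Clim (fun _ => c) c.
Proof.
  intros eps He; exists 0%nat; intros n _. replace (c - c)%C with (RtoC 0) by ring.
  rewrite Cmod_0; auto.
Qed.

Lemma is_Clim_mult (u v : nat -> C) (l l' : C) : is_Clim u l -> is_Clim v l' ->
  is_Clim (fun n => u n * v n)%C (l * l')%C.
Proof.
  intros Hu Hv eps He.
  pose proof (Cmod_ge_0 l). pose proof (Cmod_ge_0 l').
  set (d := Rmin 1 (eps / (Cmod l + Cmod l' + 1))).
  assert (Hd : 0 < d).
  { apply Rmin_glb_lt; [lra|]. apply Rdiv_lt_0_compat; lra. }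
  assert (Hd1 : d <= 1) by apply Rmin_l.
  assert (Hd2 : d * (Cmod l + Cmod l' + 1) <= eps).
  { apply Rle_trans with (eps / (Cmod l + Cmod l' + 1) * (Cmod l + Cmod l' + 1)).
    - apply Rmult_le_compat_r; [lra|apply Rmin_r].
    - right; field; lra. }
  destruct (Hu d Hd) as [N1 H1]. destruct (Hv d Hd) as [N2 H2].
  exists (N1 + N2)%nat; intros n Hn.
  specialize (H1 n ltac:(lia)). specialize (H2 n ltac:(lia)).
  replace (u n * v n - l * l')%C
    with ((u n - l) * (v n - l') + ((u n - l) * l' + l * (v n - l')))%C by ring.
  eapply Rle_lt_trans; [apply Cmod_triangle|].
  eapply Rle_lt_trans; [apply Rplus_le_compat_l, Cmod_triangle|].
  rewrite !Cmod_mult.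
  pose proof (Cmod_ge_0 (u n - l)). pose proof (Cmod_ge_0 (v n - l')). nra.
Qed.

Lemma is_Clim_pow (u : nat -> C) (l : C) (k : nat) : is_Clim u l ->
  is_Clim (fun n => u n ^ k)%C (l ^ k)%C.
Proof.
  intros H; induction k as [|k IH]; cbn [Cpow].
  - apply is_Clim_const.
  - apply is_Clim_mult; auto.
Qed.

Lemma geometric_steps_converge (u : nat -> C) (A x : R) : 0 <= x < 1 ->
  (forall n, Cmod (u (S n) - u n)%C <= A * x ^ n) -> exists l, is_Clim u l.
Proof.
  intros Hx H.
  destruct (ex_series_le (V := C_CompleteNormedModule)
              (fun n => (u (S n) - u n)%C) (fun n => A * x ^ n)) as [l Hl].
  { exact H. }
  { apply (ex_series_scal A (fun n => x ^ n)). apply ex_series_geom. rewrite Rabs_right; lra. }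
  assert (Hl' : is_Clim (sum_n (G := C_AbelianMonoid) (fun n => (u (S n) - u n)%C)) l).
  { apply is_Clim_filterlim. exact Hl. }
  exists (l + u 0%nat)%C. apply is_Clim_S.
  intros eps He. destruct (Hl' eps He) as [N HN]. exists N; intros n Hn.
  specialize (HN n Hn).
  assert (E : forall k, sum_n (G := C_AbelianMonoid) (fun n => (u (S n) - u n)%C) k
                  = (u (S k) - u 0%nat)%C).
  { induction k as [|k IH]; [apply sum_O|]. rewrite sum_Sn, IH.
    change (u (S k) - u 0%nat + (u (S (S k)) - u (S k)) = u (S (S k)) - u 0%nat)%C. ring. }
  rewrite E in HN. replace (u (S n) - (l + u 0%nat))%C with (u (S n) - u 0%nat - l)%C by ring.
  auto.
Qed.

Lemma geom_sum_le (x : R) (m n : nat) : 0 <= x < 1 -> (m <= n)%nat ->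
  (x ^ m - x ^ n) / (1 - x) <= x ^ m / (1 - x).
Proof.
  intros Hx Hn. apply Rmult_le_compat_r; [left; apply Rinv_0_lt_compat; lra|].
  pose proof (pow_le x n (proj1 Hx)). lra.
Qed.

(* A sequence of functions whose steps have geometrically small Lipschitz constants. *)
Section LipschitzLimit.
Variables (u : nat -> C -> C) (r A x : R).
Hypothesis Hr : 0 <= r.
Hypothesis HA : 0 <= A.
Hypothesis Hx : 0 <= x < 1.
Hypothesis Hu0 : forall n, u n 0 = u 0%nat 0.
Hypothesis Hstep : forall n q q', Cmod q <= r -> Cmod q' <= r ->
  Cmod (u (S n) q - u n q - (u (S n) q' - u n q'))%C <= A * x ^ n * Cmod (q - q')%C.

Lemma lip_limit_exists (q : C) : Cmod q <= r -> exists l, is_Clim (fun n => u n q) l.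
Proof.
  intros Hq. apply (geometric_steps_converge _ (A * r) x Hx). intros n.
  pose proof (Hstep n q 0 Hq ltac:(rewrite Cmod_0; lra)) as H.
  rewrite (Hu0 (S n)), (Hu0 n) in H.
  replace (u (S n) q - u n q - (u 0%nat 0 - u 0%nat 0))%C with (u (S n) q - u n q)%C in H by ring.
  replace (q - 0)%C with q in H by ring.
  eapply Rle_trans; [exact H|].
  assert (0 <= A * x ^ n) by (apply Rmult_le_pos; auto; apply pow_le; lra). nra.
Qed.

Lemma lip_partial (m n : nat) (q q' : C) : (m <= n)%nat -> Cmod q <= r -> Cmod q' <= r ->
  Cmod (u n q - u n q' - (u m q - u m q'))%C
    <= A * ((x ^ m - x ^ n) / (1 - x)) * Cmod (q - q')%C.
Proof.
  intros Hmn Hq Hq'; induction Hmn as [|n Hmn IH].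
  - replace (u m q - u m q' - (u m q - u m q'))%C with (RtoC 0) by ring.
    rewrite Cmod_0. right; field; lra.
  - replace (u (S n) q - u (S n) q' - (u m q - u m q'))%C
      with ((u n q - u n q' - (u m q - u m q'))
            + (u (S n) q - u n q - (u (S n) q' - u n q')))%C by ring.
    eapply Rle_trans; [apply Cmod_triangle|].
    pose proof (Hstep n q q' Hq Hq') as H.
    replace (A * ((x ^ m - x ^ S n) / (1 - x)) * Cmod (q - q')%C)
      with (A * ((x ^ m - x ^ n) / (1 - x)) * Cmod (q - q')%C + A * x ^ n * Cmod (q - q')%C)
      by (cbn [pow]; field; lra).
    lra.
Qed.

(** One bound serves two purposes: with q' = 0 it measures a truncation error, and for general q' it
    feeds the contraction estimate. *)
Lemma lip_limit (m : nat) (q q' l l' : C) : Cmod q <= r -> Cmod q' <= r ->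
  is_Clim (fun n => u n q) l -> is_Clim (fun n => u n q') l' ->
  Cmod (l - l' - (u m q - u m q'))%C <= A * (x ^ m / (1 - x)) * Cmod (q - q')%C.
Proof.
  intros Hq Hq' Hl Hl'.
  apply (is_Clim_Cmod_le _ _ _ _ _ m _ Hl Hl'). intros n Hn.
  eapply Rle_trans; [apply lip_partial; auto|].
  apply Rmult_le_compat_r; [apply Cmod_ge_0|]. apply Rmult_le_compat_l; auto.
  apply geom_sum_le; auto.
Qed.
End LipschitzLimit.

Lemma Cpow_sub_le (n : nat) (r : R) (q q' : C) : Cmod q <= r -> Cmod q' <= r ->
  Cmod (q ^ S n - q' ^ S n)%C <= INR (S n) * r ^ n * Cmod (q - q')%C.
Proof.
  intros Hq Hq'. assert (Hr : 0 <= r) by (pose proof (Cmod_ge_0 q); lra).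
  induction n as [|n IH].
  - cbn. rewrite !Cmult_1_r; lra.
  - replace (q ^ S (S n) - q' ^ S (S n))%C
      with (q * (q ^ S n - q' ^ S n) + (q - q') * q' ^ S n)%C by (cbn [Cpow]; ring).
    eapply Rle_trans; [apply Cmod_triangle|]. rewrite !Cmod_mult, Cmod_pow.
    assert (Cmod q' ^ S n <= r ^ S n) by (apply pow_incr; split; auto; apply Cmod_ge_0).
    pose proof (Cmod_ge_0 (q - q')). pose proof (Cmod_ge_0 q).
    pose proof (Cmod_ge_0 (q ^ S n - q' ^ S n)).
    rewrite (S_INR (S n)). cbn [pow] in *. nra.
Qed.

Lemma list_sum_cubes_le (l : list nat) (n : nat) : (forall d, In d l -> (d <= n)%nat) ->
  (list_sum (map (fun d => Nat.pow d 3) l) <= length l * Nat.pow n 3)%nat.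
Proof.
  induction l as [|d l IH]; intros H; [reflexivity|].
  cbn [map list_sum fold_right length].
  assert (Nat.pow d 3 <= Nat.pow n 3)%nat by (apply Nat.pow_le_mono_l, H; left; auto).
  assert (list_sum (map (fun d => Nat.pow d 3) l) <= length l * Nat.pow n 3)%nat
    by (apply IH; intros; apply H; right; auto).
  unfold list_sum in *. nia.
Qed.

Lemma sigma3_le (n : nat) : (sigma3 n <= Nat.pow n 4)%nat.
Proof.
  unfold sigma3. eapply Nat.le_trans; [apply (list_sum_cubes_le _ n)|].
  - intros d Hd. apply filter_In in Hd. destruct Hd as [Hd _]. apply in_seq in Hd. lia.
  - change (Nat.pow n 4) with (n * Nat.pow n 3)%nat. apply Nat.mul_le_mono_r.
    rewrite <- (length_seq n 1) at 2. apply filter_length_le.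
Qed.

(** Equality holds at n = 4, which dictates the constant; from 5 on, a step multiplies n ^ 5 by at
    most (5/4) ^ 5 < 4. *)
Lemma pow5_le (n : nat) : INR n ^ 5 <= 4 * 4 ^ n.
Proof.
  destruct (Nat.le_gt_cases n 4) as [Hn|Hn].
  - do 5 (destruct n as [|n]; [INR_literal; cbn [pow]; lra|]). lia.
  - induction Hn as [|n Hn IH]; [INR_literal; cbn [pow]; lra|].
    assert (INR n >= 5) by (replace 5 with (INR 5) by (cbn; ring); apply Rle_ge, le_INR; lia).
    rewrite S_INR. apply Rle_trans with ((INR n * (5 / 4)) ^ 5).
    + apply pow_incr; lra.
    + replace ((INR n * (5 / 4)) ^ 5) with (INR n ^ 5 * (3125 / 1024)) by field.
      change (4 ^ S n) with (4 * 4 ^ n). assert (0 <= 4 ^ n) by (apply pow_le; lra). lra.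
Qed.

(** The extra factor n is the one that the Lipschitz constant of q ^ n brings. *)
Lemma sigma3_growth (n : nat) : INR (sigma3 n) * INR n <= 4 * 4 ^ n.
Proof.
  eapply Rle_trans; [|apply pow5_le].
  replace (INR n ^ 5) with (INR (Nat.pow n 4) * INR n) by (rewrite pow_INR; ring).
  apply Rmult_le_compat_r; [apply pos_INR|]. apply le_INR, sigma3_le.
Qed.

Definition eis_term (q : C) (k : nat) : C := (INR (sigma3 (S k)) * q ^ S k)%C.
(** [sum_n] includes its last index, so the highest power is q ^ (n + 1). *)
Definition eis_sum (n : nat) (q : C) : C := sum_n (G := C_AbelianMonoid) (eis_term q) n.
Definition eis (q : C) : C := (1 + 240 * CSeries (eis_term q))%C.
Definition qprod (n : nat) (q : C) : C := Cprod (fun k => 1 - q ^ S k)%C n.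
Definition euler (q : C) : C := Clim_seq (fun n => qprod n q).

Lemma E4_eis (tau : C) : E4 tau = eis (nome tau).
Proof. reflexivity. Qed.

Lemma eis_sum_S (n : nat) (q : C) : eis_sum (S n) q = (eis_sum n q + eis_term q (S n))%C.
Proof. unfold eis_sum. rewrite sum_Sn. reflexivity. Qed.

Lemma eis_sum_0 (n : nat) : eis_sum n 0 = 0.
Proof.
  induction n as [|n IH].
  - unfold eis_sum; rewrite sum_O; unfold eis_term; cbn [Cpow]; ring.
  - rewrite eis_sum_S, IH; unfold eis_term; cbn [Cpow]; ring.
Qed.

Lemma eis_step (r : R) (n : nat) (q q' : C) : Cmod q <= r -> Cmod q' <= r ->
  Cmod (eis_sum (S n) q - eis_sum n q - (eis_sum (S n) q' - eis_sum n q'))%C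
    <= 64 * r * (4 * r) ^ n * Cmod (q - q')%C.
Proof.
  intros Hq Hq'. assert (Hr : 0 <= r) by (pose proof (Cmod_ge_0 q); lra).
  rewrite !eis_sum_S.
  replace (eis_sum n q + eis_term q (S n) - eis_sum n q
           - (eis_sum n q' + eis_term q' (S n) - eis_sum n q'))%C
    with (INR (sigma3 (S (S n))) * (q ^ S (S n) - q' ^ S (S n)))%C
    by (unfold eis_term; ring).
  rewrite Cmod_mult, Cmod_R, Rabs_right by (apply Rle_ge, pos_INR).
  pose proof (Cpow_sub_le (S n) r q q' Hq Hq') as H.
  pose proof (sigma3_growth (S (S n))) as G.
  pose proof (pos_INR (sigma3 (S (S n)))) as Hp.
  pose proof (Cmod_ge_0 (q - q')) as Hd.
  pose proof (pow_le r (S n) Hr) as Hrn.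
  apply Rle_trans with (INR (sigma3 (S (S n))) * INR (S (S n)) * (r ^ S n * Cmod (q - q')%C)).
  { rewrite Rmult_assoc. apply Rmult_le_compat_l; auto. lra. }
  apply Rle_trans with (4 * 4 ^ S (S n) * (r ^ S n * Cmod (q - q')%C)).
  { apply Rmult_le_compat_r; auto. apply Rmult_le_pos; auto. }
  right. rewrite Rpow_mult_distr. cbn [pow]. ring.
Qed.

Lemma eis_lip (r : R) (m : nat) (q q' : C) : r < 1 / 4 -> Cmod q <= r -> Cmod q' <= r ->
  Cmod (eis q - eis q' - 240 * (eis_sum m q - eis_sum m q'))%C
    <= 240 * (64 * r * ((4 * r) ^ m / (1 - 4 * r))) * Cmod (q - q')%C.
Proof.
  intros Hr1 Hq Hq'. assert (Hr : 0 <= r) by (pose proof (Cmod_ge_0 q); lra).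
  assert (Hu0 : forall n, eis_sum n 0 = eis_sum 0 0) by (intros; rewrite !eis_sum_0; auto).
  pose proof (lip_limit_exists eis_sum r (64 * r) (4 * r) Hr ltac:(lra) ltac:(lra) Hu0 (eis_step r))
    as Hex.
  destruct (Hex q Hq) as [l Hl]. destruct (Hex q' Hq') as [l' Hl'].
  pose proof (lip_limit eis_sum r (64 * r) (4 * r) ltac:(lra) ltac:(lra) (eis_step r) m q q' l l'
                Hq Hq' Hl Hl') as H.
  unfold eis. rewrite (CSeries_unique _ _ Hl), (CSeries_unique _ _ Hl').
  replace (1 + 240 * l - (1 + 240 * l') - 240 * (eis_sum m q - eis_sum m q'))%C
    with (240 * (l - l' - (eis_sum m q - eis_sum m q')))%C by ring.
  rewrite Cmod_mult, Cmod_R, Rabs_right by lra. lra.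
Qed.

Lemma eis_0 : eis 0 = 1.
Proof.
  unfold eis. rewrite (CSeries_unique _ 0).
  - ring.
  - apply (is_Clim_ext (fun _ => RtoC 0)).
    + intros n. symmetry. apply (eis_sum_0 n).
    + apply is_Clim_const.
Qed.

Lemma qprod_S (n : nat) (q : C) : qprod (S n) q = (qprod n q * (1 - q ^ S n))%C.
Proof. reflexivity. Qed.

Lemma qprod_0 (n : nat) : qprod n 0 = 1.
Proof.
  induction n as [|n IH]; [reflexivity|]. rewrite qprod_S, IH; cbn [Cpow]; ring.
Qed.

Lemma S_le_pow2 (n : nat) : INR (S n) <= 2 ^ n.
Proof.
  induction n as [|n IH]; [cbn; lra|]. rewrite !S_INR in *. cbn [pow].
  pose proof (pos_INR n). lra.
Qed.

(** The Lipschitz constant 2 and the bound 2 are hypotheses because [qprod_lip] derives them in turn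
    from this step, by induction. *)
Lemma qprod_step (r : R) (n : nat) (q q' : C) : r <= 1 / 16 -> Cmod q <= r -> Cmod q' <= r ->
  Cmod (qprod (S n) q - qprod (S n) q')%C <= 2 * Cmod (q - q')%C ->
  Cmod (qprod (S n) q') <= 2 ->
  Cmod (qprod (S (S n)) q - qprod (S n) q - (qprod (S (S n)) q' - qprod (S n) q'))%C
    <= 4 * (2 * r) ^ S n * Cmod (q - q')%C.
Proof.
  intros Hr1 Hq Hq' HL HB. assert (Hr : 0 <= r) by (pose proof (Cmod_ge_0 q); lra).
  rewrite !(qprod_S (S n)).
  set (p := qprod (S n) q) in *; set (p' := qprod (S n) q') in *.
  replace (p * (1 - q ^ S (S n)) - p - (p' * (1 - q' ^ S (S n)) - p'))%C
    with (- (q ^ S (S n) * (p - p') + (q ^ S (S n) - q' ^ S (S n)) * p'))%C by ring.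
  rewrite Cmod_opp. eapply Rle_trans; [apply Cmod_triangle|].
  rewrite !Cmod_mult, Cmod_pow.
  pose proof (Cpow_sub_le (S n) r q q' Hq Hq') as H.
  pose proof (S_le_pow2 (S (S n))) as HS.
  set (d := Cmod (q - q')%C) in *.
  assert (Hd : 0 <= d) by apply Cmod_ge_0.
  set (R0 := r ^ S n) in *.
  assert (HR0 : 0 <= R0) by (apply pow_le; auto).
  assert (Hqn : Cmod q ^ S (S n) <= r * R0).
  { change (r * R0) with (r ^ S (S n)). apply pow_incr; split; auto; apply Cmod_ge_0. }
  assert (0 <= Cmod q ^ S (S n)) by (apply pow_le, Cmod_ge_0).
  pose proof (Cmod_ge_0 (p - p')). pose proof (Cmod_ge_0 p').
  pose proof (Cmod_ge_0 (q ^ S (S n) - q' ^ S (S n))).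
  apply Rle_trans with (r * R0 * (2 * d) + INR (S (S n)) * R0 * d * 2).
  { apply Rplus_le_compat; apply Rmult_le_compat; auto. }
  rewrite Rpow_mult_distr. fold R0.
  rewrite (S_INR (S (S n))) in HS. cbn [pow] in HS |- *.
  assert (0 <= R0 * d) by (apply Rmult_le_pos; auto).
  replace (r * R0 * (2 * d) + INR (S (S n)) * R0 * d * 2)
    with ((R0 * d) * (2 * (r + INR (S (S n))))) by ring.
  replace (4 * (2 * 2 ^ n * R0) * d) with ((R0 * d) * (2 * (2 * (2 * 2 ^ n)))) by ring.
  apply Rmult_le_compat_l; auto. lra.
Qed.

(** The subtracted 8 (2 r) ^ (n + 1) makes the induction work: as 2 r <= 1 / 8, its decrease from
    one index to the next exceeds the step 4 (2 r) ^ (n + 1). The case n = 0 is exactly r <= 1 /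
    16. *)
Lemma qprod_lip (r : R) (n : nat) (q q' : C) : r <= 1 / 16 -> Cmod q <= r -> Cmod q' <= r ->
  Cmod (qprod (S n) q - qprod (S n) q')%C <= (2 - 8 * (2 * r) ^ S n) * Cmod (q - q')%C.
Proof.
  intros Hr1 Hq Hq'. assert (Hr : 0 <= r) by (pose proof (Cmod_ge_0 q); lra).
  revert q q' Hq Hq'. induction n as [|n IH]; intros q q' Hq Hq'.
  - unfold qprod; cbn [Cprod Cpow].
    replace (1 * (1 - q * 1) - 1 * (1 - q' * 1))%C with (- (q - q'))%C by ring.
    rewrite Cmod_opp. pose proof (Cmod_ge_0 (q - q')). cbn [pow]. nra.
  - assert (Hp : 0 <= (2 * r) ^ S n) by (apply pow_le; lra).
    pose proof (Cmod_ge_0 (q - q')) as Hd.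
    assert (HL : Cmod (qprod (S n) q - qprod (S n) q')%C <= 2 * Cmod (q - q')%C).
    { eapply Rle_trans; [apply IH; auto|]. nra. }
    assert (HB : Cmod (qprod (S n) q') <= 2).
    { specialize (IH q' 0 Hq' ltac:(rewrite Cmod_0; auto)). rewrite qprod_0 in IH.
      replace (q' - 0)%C with q' in IH by ring. pose proof (Cmod_ge_0 q').
      replace (qprod (S n) q') with (qprod (S n) q' - 1 + 1)%C by ring.
      eapply Rle_trans; [apply Cmod_triangle|]. rewrite Cmod_1. nra. }
    pose proof (qprod_step r n q q' Hr1 Hq Hq' HL HB) as H.
    specialize (IH q q' Hq Hq').
    replace (qprod (S (S n)) q - qprod (S (S n)) q')%C
      with ((qprod (S n) q - qprod (S n) q')
         + (qprod (S (S n)) q - qprod (S n) q - (qprod (S (S n)) q' - qprod (S n) q')))%C by ring.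
    eapply Rle_trans; [apply Cmod_triangle|].
    replace ((2 * r) ^ S (S n)) with (2 * r * (2 * r) ^ S n) by reflexivity.
    set (X := (2 * r) ^ S n) in *.
    assert (2 * r * X <= X * / 8) by nra. nra.
Qed.

Lemma qprod_step_lip (r : R) (n : nat) (q q' : C) : r <= 1 / 16 -> Cmod q <= r -> Cmod q' <= r ->
  Cmod (qprod (S (S n)) q - qprod (S n) q - (qprod (S (S n)) q' - qprod (S n) q'))%C
    <= 8 * r * (2 * r) ^ n * Cmod (q - q')%C.
Proof.
  intros Hr1 Hq Hq'. assert (Hr : 0 <= r) by (pose proof (Cmod_ge_0 q); lra).
  assert (0 <= (2 * r) ^ S n) by (apply pow_le; lra).
  replace (8 * r * (2 * r) ^ n) with (4 * (2 * r) ^ S n) by (cbn; ring).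
  apply qprod_step; auto.
  - pose proof (qprod_lip r n q q' Hr1 Hq Hq').
    pose proof (Cmod_ge_0 (q - q')). nra.
  - pose proof (qprod_lip r n q' 0 Hr1 Hq' ltac:(rewrite Cmod_0; auto)) as H1.
    rewrite qprod_0 in H1. replace (q' - 0)%C with q' in H1 by ring.
    pose proof (Cmod_ge_0 q').
    replace (qprod (S n) q') with (qprod (S n) q' - 1 + 1)%C by ring.
    eapply Rle_trans; [apply Cmod_triangle|]. rewrite Cmod_1. nra.
Qed.

Lemma euler_spec (r : R) (q : C) : r <= 1 / 16 -> Cmod q <= r ->
  is_Clim (fun n => qprod n q) (euler q).
Proof.
  intros Hr1 Hq. assert (Hr : 0 <= r) by (pose proof (Cmod_ge_0 q); lra).
  destruct (lip_limit_exists (fun n => qprod (S n)) r (8 * r) (2 * r) Hr ltac:(lra) ltac:(lra))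
    with (q := q) as [l Hl]; auto.
  - intros n; rewrite !qprod_0; auto.
  - intros; apply qprod_step_lip; auto.
  - apply (is_Clim_S (fun n => qprod n q)) in Hl.
    unfold euler. rewrite (Clim_seq_unique _ _ Hl). auto.
Qed.

Lemma euler_lip (r : R) (m : nat) (q q' : C) : r <= 1 / 16 -> Cmod q <= r -> Cmod q' <= r ->
  Cmod (euler q - euler q' - (qprod (S m) q - qprod (S m) q'))%C
    <= 8 * r * ((2 * r) ^ m / (1 - 2 * r)) * Cmod (q - q')%C.
Proof.
  intros Hr1 Hq Hq'. assert (Hr : 0 <= r) by (pose proof (Cmod_ge_0 q); lra).
  assert (HS : forall z, Cmod z <= r -> is_Clim (fun n => qprod (S n) z) (euler z)).
  { intros z Hz eps He. destruct (euler_spec r z Hr1 Hz eps He) as [N HN].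
    exists N; intros n Hn; apply HN; lia. }
  apply (lip_limit (fun n => qprod (S n)) r (8 * r) (2 * r)); auto; try lra.
  intros; apply qprod_step_lip; auto.
Qed.

Lemma euler_0 : euler 0 = 1.
Proof.
  unfold euler. apply Clim_seq_unique.
  apply (is_Clim_ext (fun _ => RtoC 1)); [intros; symmetry; apply qprod_0|apply is_Clim_const].
Qed.

Lemma modular_Delta_euler (r : R) (tau : C) : r <= 1 / 16 -> Cmod (nome tau) <= r ->
  modular_Delta tau = (nome tau * euler (nome tau) ^ 24)%C.
Proof.
  intros Hr Hq. unfold modular_Delta. f_equal. apply Clim_seq_unique.
  apply (is_Clim_ext (fun n => qprod n (nome tau) ^ 24)%C).
  - intros n. induction n as [|n IH]; [apply Cpow_1_l|].
    cbn [Cprod]. rewrite <- IH, qprod_S, Cpow_mult_l. reflexivity.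
  - apply is_Clim_pow, (euler_spec r); auto.
Qed.

(** * Solving j(tau) = zeta near rho *)

Lemma contraction_fixpoint (K : C -> C) (r k : R) : 0 <= r -> 0 <= k < 1 ->
  (forall w w', Cmod w <= r -> Cmod w' <= r -> Cmod (K w - K w')%C <= k * Cmod (w - w')%C) ->
  Cmod (K 0) <= (1 - k) * r ->
  exists w, Cmod w <= r /\ K w = w.
Proof.
  intros Hr Hk HK HK0.
  set (u := fun n => Nat.iter n K (RtoC 0)).
  assert (HuS : forall n, u (S n) = K (u n)) by reflexivity.
  assert (Hur : forall n, Cmod (u n) <= r).
  { induction n as [|n IH]; [change (u 0%nat) with (RtoC 0); rewrite Cmod_0; auto|].
    rewrite HuS.
    pose proof (HK (u n) 0 IH ltac:(rewrite Cmod_0; auto)) as H.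
    replace (u n - 0)%C with (u n) in H by ring.
    replace (K (u n)) with (K (u n) - K 0 + K 0)%C by ring.
    eapply Rle_trans; [apply Cmod_triangle|]. nra. }
  assert (Hstep : forall n, Cmod (u (S n) - u n)%C <= Cmod (K 0) * k ^ n).
  { induction n as [|n IH].
    - replace (u 1%nat - u 0%nat)%C with (K 0)
        by (change (u 1%nat) with (K 0); change (u 0%nat) with (RtoC 0); ring).
      rewrite pow_O; lra.
    - rewrite (HuS (S n)). rewrite (HuS n) at 2.
      eapply Rle_trans; [apply HK; auto|]. cbn [pow]. nra. }
  destruct (geometric_steps_converge u (Cmod (K 0)) k Hk Hstep) as [l Hl].
  assert (Hlr : Cmod l <= r).
  { replace l with (l - 0 - 0)%C by ring.
    apply (is_Clim_Cmod_le _ _ _ _ _ 0 _ Hl (is_Clim_const 0)). intros n _.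
    replace (u n - 0 - 0)%C with (u n) by ring. auto. }
  exists l; split; auto.
  assert (H0 : Cmod (K l - l)%C <= 0).
  { apply le_epsilon. intros eps He. destruct (Hl (eps / 2)) as [N HN]; [lra|].
    pose proof (HN N (le_n _)) as H1. pose proof (HN (S N) ltac:(lia)) as H2.
    rewrite HuS in H2.
    pose proof (HK l (u N) Hlr (Hur N)) as H3.
    replace (l - u N)%C with (- (u N - l))%C in H3 by ring. rewrite Cmod_opp in H3.
    replace (K l - l)%C with (K l - K (u N) + (K (u N) - l))%C by ring.
    pose proof (Cmod_triangle (K l - K (u N)) (K (u N) - l)).
    pose proof (Cmod_ge_0 (u N - l)). nra. }
  assert (H1 : (K l - l)%C = 0) by (apply Cmod_eq_0; pose proof (Cmod_ge_0 (K l - l)); lra).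
  replace (K l) with (K l - l + l)%C by ring. rewrite H1; ring.
Qed.

Lemma Cexp_sub_1 (z : C) : Cmod (Cexp z - 1)%C <= exp (Cmod z) * Cmod z.
Proof.
  pose proof (Cexp_sum_remainder z 0 1 ltac:(lra)) as H.
  rewrite Cmult_1_l in H. cbn [Cexp_sum exp_term pow Z.of_nat Pos.of_succ_nat] in H. lra.
Qed.

Lemma segment_Cmod_le (z z' : C) (r s : R) : Cmod z <= r -> Cmod z' <= r -> 0 <= s <= 1 ->
  Cmod (z' + s * (z - z'))%C <= r.
Proof.
  intros Hz Hz' Hs.
  replace (z' + s * (z - z'))%C with ((1 - s)%R * z' + s * z)%C by (rewrite RtoC_minus; ring).
  eapply Rle_trans; [apply Cmod_triangle|]. rewrite !Cmod_mult, !Cmod_R, !Rabs_right by lra.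
  nra.
Qed.

Lemma Cexp_lip (z z' : C) (r : R) : Cmod z <= r -> Cmod z' <= r ->
  Cmod (Cexp z - Cexp z')%C <= exp r * Cmod (z - z')%C.
Proof.
  intros Hz Hz'.
  pose proof (curve_increment_le (fun x => Cexp (z' + x * (z - z')))
    (fun x => (z - z') * Cexp (z' + x * (z - z')))%C
    (fun x => exp r * Cmod (z - z')%C * x) (fun _ => exp r * Cmod (z - z')%C) 1) as H.
  cbv beta in H.
  replace (z' + 1 * (z - z'))%C with z in H by ring.
  replace (z' + 0 * (z - z'))%C with z' in H by ring.
  rewrite Rmult_0_r, Rminus_0_r, Rmult_1_r in H.
  apply H; [lra|intros; apply is_cderive_Cexp|intros; auto_derive; auto; ring|].
  intros x Hx. rewrite Cmod_mult, Rmult_comm. apply Rmult_le_compat_r; [apply Cmod_ge_0|].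
  eapply Rle_trans; [apply Cmod_Cexp_le|]. apply exp_le, segment_Cmod_le; auto.
Qed.

(** exp z - z has derivative exp z - 1, which is small near 0; this isolates the linear part of
    [j_eq]. *)
Lemma Cexp_lip1 (z z' : C) (r : R) : Cmod z <= r -> Cmod z' <= r ->
  Cmod (Cexp z - Cexp z' - (z - z'))%C <= r * exp r * Cmod (z - z')%C.
Proof.
  intros Hz Hz'.
  pose proof (curve_increment_le (fun x => Cexp (z' + x * (z - z')) + - (x * (z - z')))%C
    (fun x => (z - z') * Cexp (z' + x * (z - z')) + - (1 * (z - z')))%C
    (fun x => r * exp r * Cmod (z - z')%C * x) (fun _ => r * exp r * Cmod (z - z')%C) 1) as H.
  cbv beta in H.
  replace (z' + 1 * (z - z'))%C with z in H by ring.
  replace (z' + 0 * (z - z'))%C with z' in H by ring.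
  rewrite Rmult_0_r, Rminus_0_r, Rmult_1_r in H.
  replace (Cexp z - Cexp z' - (z - z'))%C
    with (Cexp z + - (1 * (z - z')) - (Cexp z' + - (0 * (z - z'))))%C by ring.
  apply H; [lra| |intros; auto_derive; auto; ring|].
  - intros x. apply is_cderive_plus; [apply is_cderive_Cexp|].
    apply is_cderive_opp. apply (is_cderive_real (fun y => y)).
    exact (is_derive_id x).
  - intros x Hx.
    replace ((z - z') * Cexp (z' + x * (z - z')) + - (1 * (z - z')))%C
      with ((Cexp (z' + x * (z - z')) - 1) * (z - z'))%C by ring.
    rewrite Cmod_mult. apply Rmult_le_compat_r; [apply Cmod_ge_0|].
    eapply Rle_trans; [apply Cexp_sub_1|].
    pose proof (segment_Cmod_le z z' r x Hz Hz' Hx) as Hs.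
    rewrite Rmult_comm. apply Rmult_le_compat; auto using exp_le, Cmod_ge_0.
    left; apply exp_pos.
Qed.

Definition q_of (w : C) : C := (- c * Cexp w)%C.

Lemma c_pos : 0 < c.
Proof. apply exp_pos. Qed.

(* Bounds [q_of w] for [Cmod w <= 3 / 10]. *)
Definition q_max : R := 59 / 10000.

Lemma Cmod_q_of (w : C) : Cmod w <= 3 / 10 -> Cmod (q_of w) <= q_max.
Proof.
  intros Hw. unfold q_of. rewrite Cmod_mult, Cmod_opp, Cmod_R, Rabs_right
    by (left; apply c_pos).
  apply Rle_trans with (c * exp (3 / 10)).
  - apply Rmult_le_compat_l; [left; apply c_pos|].
    eapply Rle_trans; [apply Cmod_Cexp_le|apply exp_le; auto].
  - unfold q_max; enclose_cmp.
Qed.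

Lemma q_of_lip (w w' : C) : Cmod w <= 3 / 10 -> Cmod w' <= 3 / 10 ->
  Cmod (q_of w - q_of w')%C <= q_max * Cmod (w - w')%C.
Proof.
  intros Hw Hw'. unfold q_of.
  replace (- c * Cexp w - - c * Cexp w')%C with (- (c * (Cexp w - Cexp w')))%C by ring.
  rewrite Cmod_opp, Cmod_mult, Cmod_R, Rabs_right by (left; apply c_pos).
  pose proof (Cexp_lip w w' _ Hw Hw'). pose proof c_pos. pose proof (Cmod_ge_0 (w - w')).
  apply Rle_trans with (c * exp (3 / 10) * Cmod (w - w')%C).
  - rewrite Rmult_assoc. apply Rmult_le_compat_l; lra.
  - apply Rmult_le_compat_r; auto. unfold q_max; enclose_cmp.
Qed.

(** [j_eq_lip] treats the terms 1 + 240 q exactly and bounds only this rest. *)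
Definition eis_tail (q : C) : C := (eis q - 1 - 240 * q)%C.

Lemma eis_sum_1 (q : C) : eis_sum 1 q = (q + 9 * q ^ 2)%C.
Proof.
  rewrite eis_sum_S. unfold eis_sum. rewrite sum_O. unfold eis_term.
  replace (INR (sigma3 1)) with 1 by reflexivity.
  replace (INR (sigma3 2)) with 9 by (cbn; ring). cbn [Cpow]. ring.
Qed.

Lemma eis_tail_lip (q q' : C) : Cmod q <= q_max -> Cmod q' <= q_max ->
  Cmod (eis_tail q - eis_tail q')%C <= 277 / 10 * Cmod (q - q')%C.
Proof.
  intros Hq Hq'. unfold eis_tail.
  pose proof (eis_lip q_max 1 q q' ltac:(unfold q_max; lra) Hq Hq') as H.
  rewrite !eis_sum_1 in H.
  replace (eis q - 1 - 240 * q - (eis q' - 1 - 240 * q'))%C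
    with (eis q - eis q' - 240 * (q + 9 * q ^ 2 - (q' + 9 * q' ^ 2))
          + 2160 * ((q + q') * (q - q')))%C by (cbn [Cpow]; ring).
  eapply Rle_trans; [apply Cmod_triangle|].
  rewrite !Cmod_mult, Cmod_R, Rabs_right by lra.
  pose proof (Cmod_triangle q q'). pose proof (Cmod_ge_0 (q - q')).
  apply Rle_trans with ((240 * (64 * q_max * ((4 * q_max) ^ 1 / (1 - 4 * q_max)))
                         + 2160 * (2 * q_max)) * Cmod (q - q')%C).
  - rewrite Rmult_plus_distr_r. apply Rplus_le_compat; [exact H|].
    rewrite (Rmult_assoc 2160). apply Rmult_le_compat_l; [lra|].
    apply Rmult_le_compat_r; lra.
  - apply Rmult_le_compat_r; auto. unfold q_max. enclose_cmp.
Qed.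

Lemma eis_tail_le (q : C) : Cmod q <= q_max -> Cmod (eis_tail q) <= 9 / 100.
Proof.
  intros Hq. unfold eis_tail.
  pose proof (eis_lip q_max 1 q 0 ltac:(unfold q_max; lra) Hq
     ltac:(rewrite Cmod_0; unfold q_max; lra)) as H.
  rewrite !eis_sum_1, eis_0 in H. replace (q - 0)%C with q in H by ring.
  replace (eis q - 1 - 240 * q)%C
    with (eis q - 1 - 240 * (q + 9 * q ^ 2 - (0 + 9 * 0 ^ 2)) + 2160 * (q * q))%C
    by (cbn [Cpow]; ring).
  eapply Rle_trans; [apply Cmod_triangle|].
  rewrite !Cmod_mult, Cmod_R, Rabs_right by lra. pose proof (Cmod_ge_0 q).
  apply Rle_trans with (240 * (64 * q_max * ((4 * q_max) ^ 1 / (1 - 4 * q_max))) * q_max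
                         + 2160 * (q_max * q_max)).
  - apply Rplus_le_compat.
    + eapply Rle_trans; [exact H|]. apply Rmult_le_compat_l; auto. unfold q_max; enclose_cmp.
    + apply Rmult_le_compat_l; [lra|]. apply Rmult_le_compat; auto.
  - unfold q_max. enclose_cmp.
Qed.

Lemma euler_lip_1 (q q' : C) : Cmod q <= q_max -> Cmod q' <= q_max ->
  Cmod (euler q - euler q')%C <= 21 / 20 * Cmod (q - q')%C.
Proof.
  intros Hq Hq'.
  pose proof (euler_lip q_max 0 q q' ltac:(unfold q_max; lra) Hq Hq') as H.
  replace (euler q - euler q')%C
    with (euler q - euler q' - (qprod 1 q - qprod 1 q') + - (q - q'))%C
    by (unfold qprod; cbn [Cprod Cpow]; ring).
  eapply Rle_trans; [apply Cmod_triangle|]. rewrite Cmod_opp.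
  pose proof (Cmod_ge_0 (q - q')).
  assert (8 * q_max * ((2 * q_max) ^ 0 / (1 - 2 * q_max)) <= 1 / 20)
    by (unfold q_max; enclose_cmp). nra.
Qed.

Lemma euler_sub_1 (q : C) : Cmod q <= q_max -> Cmod (euler q - 1)%C <= 21 / 20 * Cmod q.
Proof.
  intros Hq. rewrite <- euler_0. pose proof (euler_lip_1 q 0 Hq) as H.
  replace (q - 0)%C with q in H by ring. apply H. rewrite Cmod_0; unfold q_max; lra.
Qed.

Lemma Cmod_euler_le (q : C) : Cmod q <= q_max -> Cmod (euler q) <= 101 / 100.
Proof.
  intros Hq. pose proof (euler_sub_1 q Hq).
  replace (euler q) with (euler q - 1 + 1)%C by ring.
  eapply Rle_trans; [apply Cmod_triangle|]. rewrite Cmod_1. unfold q_max in *. lra.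
Qed.

(* A zero expresses a cube root of [E4 tau ^ 3 = u ^ 3 * modular_Delta tau] for
   [nome tau = q_of w]. *)
Definition j_eq (u w : C) : C :=
  (Cexp ((- (1 / 3))%R * w) * eis (q_of w) + u * t6 ^ 2 * euler (q_of w) ^ 8)%C.

(* Minus the derivative of [j_eq u] at 0, up to smaller terms. *)
Definition slope : R := 1 / 3 + 160 * c.

(** Since exp (- w / 3) q = - c exp (2 w / 3), the terms 1 + 240 q of E4 contribute exp (- w / 3) -
    240 c exp (2 w / 3), with linear part - [slope] * w. Once this is removed, five summands with
    small Lipschitz constants remain, and these add up to less than 0.44. *)
Lemma j_eq_lip (u w w' : C) : Cmod u = 1 -> Cmod w <= 3 / 10 -> Cmod w' <= 3 / 10 ->
  Cmod (j_eq u w - j_eq u w' + slope * (w - w'))%C <= 44 / 100 * Cmod (w - w')%C.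
Proof.
  intros Hu Hw Hw'. unfold j_eq, slope.
  set (q := q_of w); set (q' := q_of w').
  assert (Hq : Cmod q <= q_max) by (apply Cmod_q_of; auto).
  assert (Hq' : Cmod q' <= q_max) by (apply Cmod_q_of; auto).
  pose proof (q_of_lip w w' Hw Hw') as Hqq. fold q q' in Hqq.
  set (d := Cmod (w - w')%C) in *. assert (Hd : 0 <= d) by apply Cmod_ge_0.
  set (x := (- (1 / 3))%R). set (y := 2 / 3).
  assert (Hscal : forall (k r : R) (v : C), Rabs k * (3 / 10) <= r -> Cmod v <= 3 / 10 ->
                    Cmod (k * v)%C <= r).
  { intros k r v Hk Hv. rewrite Cmod_mult, Cmod_R. pose proof (Rabs_pos k). nra. }
  assert (Hx : Rabs x = 1 / 3) by (unfold x; rewrite Rabs_Ropp, Rabs_right; lra).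
  assert (Hy : Rabs y = 2 / 3) by (unfold y; rewrite Rabs_right; lra).
  assert (Hdx : Cmod (x * w - x * w')%C = 1 / 3 * d).
  { replace (x * w - x * w')%C with (x * (w - w'))%C by ring.
    rewrite Cmod_mult, Cmod_R, Hx; auto. }
  assert (Hdy : Cmod (y * w - y * w')%C = 2 / 3 * d).
  { replace (y * w - y * w')%C with (y * (w - w'))%C by ring.
    rewrite Cmod_mult, Cmod_R, Hy; auto. }
  pose proof (Cexp_lip1 (x * w) (x * w') (1 / 10) ltac:(apply Hscal; lra) ltac:(apply Hscal; lra))
    as B1. rewrite Hdx in B1.
  pose proof (Cexp_lip1 (y * w) (y * w') (2 / 10) ltac:(apply Hscal; lra) ltac:(apply Hscal; lra))
    as B2. rewrite Hdy in B2.
  pose proof (Cexp_lip (x * w) (x * w') (1 / 10) ltac:(apply Hscal; lra) ltac:(apply Hscal; lra))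
    as B3. rewrite Hdx in B3.
  assert (B4 : Cmod (Cexp (x * w)) <= exp (1 / 10)).
  { eapply Rle_trans; [apply Cmod_Cexp_le|]. apply exp_le, Hscal; lra. }
  pose proof (eis_tail_lip q q' Hq Hq') as B5.
  pose proof (eis_tail_le q' Hq') as B6.
  assert (B7 : Cmod (euler q ^ 8 - euler q' ^ 8)%C <= 10 * (q_max * d)).
  { eapply Rle_trans; [apply (Cpow_sub_le 7 (101 / 100)); apply Cmod_euler_le; auto|].
    pose proof (euler_lip_1 q q' Hq Hq').
    replace (INR 8) with 8 by (rewrite INR_IZR_INZ; reflexivity).
    pose proof (Cmod_ge_0 (q - q')).
    apply Rle_trans with (8 * (101 / 100) ^ 7 * (21 / 20 * (q_max * d))); [nra|].
    assert (0 <= q_max * d) by (unfold q_max; nra). lra. }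
  assert (Ew : forall v : C, (Cexp (x * v) * q_of v)%C = (- c * Cexp (y * v))%C).
  { intros v. unfold q_of. replace (y * v)%C with (x * v + v)%C.
    - rewrite Cexp_plus; ring.
    - replace y with (x + 1) by (unfold x, y; field). rewrite RtoC_plus; ring. }
  pose proof (Ew w) as E1. pose proof (Ew w') as E2. fold q in E1. fold q' in E2.
  set (e := Cexp (x * w)) in *. set (e' := Cexp (x * w')) in *.
  set (f := Cexp (y * w)) in *. set (f' := Cexp (y * w')) in *.
  replace (e * eis q + u * t6 ^ 2 * euler q ^ 8 - (e' * eis q' + u * t6 ^ 2 * euler q' ^ 8)
           + (1 / 3 + 160 * c)%R * (w - w'))%C
    with ((e - e' - (x * w - x * w')) + (- (240 * c * (f - f' - (y * w - y * w')))
          + (e * (eis_tail q - eis_tail q') + (eis_tail q' * (e - e')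
          + u * (t6 ^ 2 * (euler q ^ 8 - euler q' ^ 8))))))%C.
  2:{ unfold eis_tail.
      replace (e * (eis q - 1 - 240 * q - (eis q' - 1 - 240 * q')) +
               ((eis q' - 1 - 240 * q') * (e - e') +
                u * (t6 ^ 2 * (euler q ^ 8 - euler q' ^ 8))))%C
        with (e * eis q - e' * eis q' - (e - e') - 240 * (e * q) + 240 * (e' * q')
               + u * (t6 ^ 2 * (euler q ^ 8 - euler q' ^ 8)))%C by ring.
      rewrite E1, E2. unfold x, y.
      rewrite RtoC_plus, RtoC_mult, RtoC_opp, !RtoC_div by lra.
      field; repeat split; apply RtoC_neq; lra. }
  assert (Ht : Cmod (t6 ^ 2)%C = t6 ^ 2).
  { rewrite Cmod_pow, Cmod_R, Rabs_right; auto. left; apply exp_pos. }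
  eapply Rle_trans.
  { do 4 (eapply Rle_trans; [apply Cmod_triangle|apply Rplus_le_compat_l]). apply Rle_refl. }
  rewrite Cmod_opp, !Cmod_mult, !Cmod_R, Hu, Ht, (Rabs_right 240), (Rabs_right c)
    by (try lra; left; apply c_pos).
  pose proof c_pos.
  assert (T2 : 240 * c * Cmod (f - f' - (y * w - y * w'))%C
               <= 240 * c * (2 / 10 * exp (2 / 10) * (2 / 3 * d))).
  { apply Rmult_le_compat_l; [lra|auto]. }
  assert (T3 : Cmod e * Cmod (eis_tail q - eis_tail q')%C
               <= exp (1 / 10) * (277 / 10 * (q_max * d))).
  { apply Rmult_le_compat; auto using Cmod_ge_0. lra. }
  assert (T4 : Cmod (eis_tail q') * Cmod (e - e')%C <= 9 / 100 * (exp (1 / 10) * (1 / 3 * d))).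
  { apply Rmult_le_compat; auto using Cmod_ge_0. }
  assert (T5 : 1 * (t6 ^ 2 * Cmod (euler q ^ 8 - euler q' ^ 8)%C) <= t6 ^ 2 * (10 * (q_max * d))).
  { rewrite Rmult_1_l. apply Rmult_le_compat_l; auto. apply pow2_ge_0. }
  apply Rle_trans with
    ((1 / 10 * exp (1 / 10) * (1 / 3) + 240 * c * (2 / 10 * exp (2 / 10) * (2 / 3))
      + exp (1 / 10) * (277 / 10 * q_max) + 9 / 100 * (exp (1 / 10) * (1 / 3))
      + t6 ^ 2 * (10 * q_max)) * d).
  { lra. }
  apply Rmult_le_compat_r; auto. unfold q_max. enclose_cmp.
Qed.

Lemma Cmod_t6_sq : Cmod (t6 ^ 2)%C = t6 ^ 2.
Proof. rewrite Cmod_pow, Cmod_R, Rabs_right; auto. left; apply exp_pos. Qed.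

Lemma eis_sum_4 (q : C) :
  eis_sum 4 q = (q + 9 * q ^ 2 + 28 * q ^ 3 + 73 * q ^ 4 + 126 * q ^ 5)%C.
Proof.
  rewrite !eis_sum_S. unfold eis_sum. rewrite sum_O. unfold eis_term.
  replace (INR (sigma3 1)) with 1 by reflexivity.
  replace (INR (sigma3 2)) with 9 by (rewrite INR_IZR_INZ; reflexivity).
  replace (INR (sigma3 3)) with 28 by (rewrite INR_IZR_INZ; reflexivity).
  replace (INR (sigma3 4)) with 73 by (rewrite INR_IZR_INZ; reflexivity).
  replace (INR (sigma3 5)) with 126 by (rewrite INR_IZR_INZ; reflexivity).
  cbn [Cpow]; ring.
Qed.

Definition eis_poly (q : C) : C :=
  (1 + 240 * q + 2160 * q ^ 2 + 6720 * q ^ 3 + 17520 * q ^ 4 + 30240 * q ^ 5)%C.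

Lemma eis_approx (q : C) : Cmod q <= q_max ->
  Cmod (eis q - eis_poly q)%C <= 2 / 10 ^ 7.
Proof.
  intros Hq.
  pose proof (eis_lip q_max 4 q 0 ltac:(unfold q_max; lra) Hq
     ltac:(rewrite Cmod_0; unfold q_max; lra)) as H.
  rewrite eis_sum_0, eis_sum_4, eis_0 in H. replace (q - 0)%C with q in H by ring.
  replace (eis q - eis_poly q)%C
    with (eis q - 1 - 240 * (q + 9 * q ^ 2 + 28 * q ^ 3 + 73 * q ^ 4 + 126 * q ^ 5 - 0))%C
    by (unfold eis_poly; ring).
  eapply Rle_trans; [exact H|].
  apply Rle_trans with (240 * (64 * q_max * ((4 * q_max) ^ 4 / (1 - 4 * q_max))) * q_max).
  - apply Rmult_le_compat_l; auto. unfold q_max; enclose_cmp.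
  - unfold q_max; enclose_cmp.
Qed.

(** 1 - q - q ^ 2 begins Euler's pentagonal series, whose next term is q ^ 5. The square is the
    twelfth root of the product in Delta, which is what [Dfun] contains. *)
Lemma euler_approx (q : C) : Cmod q <= q_max ->
  Cmod (euler q ^ 2 - (1 - q - q ^ 2) ^ 2)%C <= 11 / 10 ^ 10.
Proof.
  intros Hq. pose proof (Cmod_ge_0 q) as Hq0.
  pose proof (euler_lip q_max 3 q 0 ltac:(unfold q_max; lra) Hq
     ltac:(rewrite Cmod_0; unfold q_max; lra)) as H.
  rewrite euler_0, qprod_0 in H. replace (q - 0)%C with q in H by ring.
  set (e := (euler q - 1 - (qprod 4 q - 1))%C) in *.
  assert (He : Cmod e <= 47 / 10 ^ 11).
  { eapply Rle_trans; [exact H|].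
    apply Rle_trans with (8 * q_max * ((2 * q_max) ^ 3 / (1 - 2 * q_max)) * q_max).
    - apply Rmult_le_compat_l; auto. unfold q_max; enclose_cmp.
    - unfold q_max; enclose_cmp. }
  set (p := (1 - q - q ^ 2)%C).
  (* The exact difference between the product of the first four factors and 1 - q - q ^ 2. *)
  set (f := (q ^ 5 * (2 - q ^ 3 - q ^ 4 + q ^ 5))%C).
  assert (E : euler q = (p + (f + e))%C).
  { unfold e, f, p, qprod; cbn [Cprod Cpow]. ring. }
  assert (Hpow : forall n, Cmod (q ^ n)%C <= q_max ^ n).
  { intros n. rewrite Cmod_pow. apply pow_incr; auto. }
  assert (Hf : Cmod f <= 3 / 10 ^ 11).
  { unfold f. rewrite Cmod_mult.
    assert (Cmod (2 - q ^ 3 - q ^ 4 + q ^ 5)%C <= 3).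
    { eapply Rle_trans; [apply Cmod_triangle|]. unfold Cminus at 1.
      eapply Rle_trans; [apply Rplus_le_compat_r, Cmod_triangle|].
      eapply Rle_trans; [apply Rplus_le_compat_r, Rplus_le_compat_r, Cmod_triangle|].
      rewrite !Cmod_opp, Cmod_R, Rabs_right by lra.
      pose proof (Hpow 3%nat). pose proof (Hpow 4%nat). pose proof (Hpow 5%nat).
      unfold q_max in *. lra. }
    apply Rle_trans with (q_max ^ 5 * 3).
    - apply Rmult_le_compat; auto using Cmod_ge_0.
    - unfold q_max; enclose_cmp. }
  assert (Hp : Cmod p <= 101 / 100).
  { unfold p, Cminus. eapply Rle_trans; [apply Cmod_triangle|].
    eapply Rle_trans; [apply Rplus_le_compat_r, Cmod_triangle|].
    rewrite !Cmod_opp, Cmod_1. pose proof (Hpow 2%nat). unfold q_max in *. lra. }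
  rewrite E. replace ((p + (f + e)) ^ 2 - p ^ 2)%C with ((f + e) * (2 * p + (f + e)))%C
    by (cbn [Cpow]; ring).
  rewrite Cmod_mult.
  pose proof (Cmod_triangle f e). pose proof (Cmod_triangle (2 * p) (f + e)) as H2.
  rewrite Cmod_mult, Cmod_R, Rabs_right in H2 by lra.
  pose proof (Cmod_ge_0 (f + e)).
  apply Rle_trans with (5 / 10 ^ 10 * (203 / 100)); [|lra].
  apply Rmult_le_compat; auto using Cmod_ge_0; lra.
Qed.

(** Newton's map with the derivative frozen at - [slope]. Because E4 (rho) is tiny, |j_eq u 0| is
    about t6 ^ 2 |euler| ^ 8, that is 0.169, just below the (1.02 - 0.44) * 0.3 = 0.174 that keeps
    the disc invariant. *)
Lemma j_eq_root (u : C) : Cmod u = 1 ->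
  exists w, Cmod w <= 3 / 10 /\ j_eq u w = 0.
Proof.
  intros Hu.
  assert (Hs : 102 / 100 <= slope) by (unfold slope; enclose_cmp).
  assert (Hs0 : RtoC slope <> 0) by (apply RtoC_neq; lra).
  assert (Hms : forall z, Cmod (z / slope)%C = Cmod z / slope).
  { intros z. rewrite Cmod_div, Cmod_R, Rabs_right; auto; lra. }
  destruct (contraction_fixpoint (fun w => w + j_eq u w / slope)%C (3 / 10) (44 / 100 / slope))
    as [w [Hw E]].
  - lra.
  - split; [apply Rmult_le_pos; [lra|left; apply Rinv_0_lt_compat; lra]|].
    apply Rmult_lt_reg_r with slope; [lra|].
    unfold Rdiv; rewrite Rmult_assoc, Rinv_l by lra. lra.
  - intros w w' Hw Hw'.
    replace (w + j_eq u w / slope - (w' + j_eq u w' / slope))%C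
      with ((j_eq u w - j_eq u w' + slope * (w - w')) / slope)%C by (field; auto).
    rewrite Hms.
    apply Rle_trans with (44 / 100 * Cmod (w - w')%C / slope); [|right; field; lra].
    apply Rmult_le_compat_r; [left; apply Rinv_0_lt_compat; lra|].
    apply j_eq_lip; auto.
  - rewrite Cplus_0_l, Hms.
    apply Rmult_le_reg_r with slope; [lra|].
    replace (Cmod (j_eq u 0) / slope * slope) with (Cmod (j_eq u 0)) by (field; lra).
    replace ((1 - 44 / 100 / slope) * (3 / 10) * slope) with ((slope - 44 / 100) * (3 / 10))
      by (field; lra).
    apply Rle_trans with (174 / 1000); [|lra].
    unfold j_eq. rewrite Cmult_0_r, Cexp_0, Cmult_1_l.
    assert (Hq : Cmod (q_of 0) <= q_max) by (apply Cmod_q_of; rewrite Cmod_0; lra).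
    pose proof (eis_approx _ Hq) as H1. pose proof (Cmod_euler_le _ Hq) as H2.
    assert (H3 : Cmod (euler (q_of 0)) <= 1 + 21 / 20 * c).
    { pose proof (euler_sub_1 _ Hq) as H.
      replace (Cmod (q_of 0)) with c in H.
      - replace (euler (q_of 0)) with (1 + (euler (q_of 0) - 1))%C by ring.
        eapply Rle_trans; [apply Cmod_triangle|]. rewrite Cmod_1. lra.
      - unfold q_of. rewrite Cexp_0, Cmult_1_r, Cmod_opp, Cmod_R, Rabs_right; auto.
        left; apply c_pos. }
    (* The numerical form of E4 (rho) = 0. *)
    assert (H4 : Cmod (eis_poly (q_of 0)) <= 1 / 10 ^ 6).
    { replace (eis_poly (q_of 0))
        with (RtoC (1 - 240 * c + 2160 * c ^ 2 - 6720 * c ^ 3 + 17520 * c ^ 4 - 30240 * c ^ 5)).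
      - rewrite Cmod_R. enclose_cmp.
      - unfold eis_poly, q_of. rewrite Cexp_0.
        rewrite !RtoC_minus, !RtoC_plus, !RtoC_minus, !RtoC_plus, !RtoC_minus.
        rewrite !RtoC_mult, !RtoC_pow.
        ring. }
    eapply Rle_trans; [apply Cmod_triangle|].
    rewrite !Cmod_mult, Hu, Cmod_t6_sq, Rmult_1_l, Cmod_pow.
    assert (H5 : Cmod (eis (q_of 0)) <= 2 / 10 ^ 6).
    { replace (eis (q_of 0))
        with (eis_poly (q_of 0) + (eis (q_of 0) - eis_poly (q_of 0)))%C by ring.
      eapply Rle_trans; [apply Cmod_triangle|]. lra. }
    assert (H6 : t6 ^ 2 * Cmod (euler (q_of 0)) ^ 8 <= t6 ^ 2 * (1 + 21 / 20 * c) ^ 8).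
    { apply Rmult_le_compat_l; [apply pow2_ge_0|]. apply pow_incr; auto using Cmod_ge_0. }
    apply Rle_trans with (2 / 10 ^ 6 + t6 ^ 2 * (1 + 21 / 20 * c) ^ 8); [lra|]. enclose_cmp.
  - exists w; split; auto.
    replace (j_eq u w) with (slope * (w + j_eq u w / slope - w))%C by (field; auto).
    rewrite E. ring.
Qed.

(** * Taylor expansions at rho *)

(* [D_list] encodes exp (w / 12) (1 - q - q ^ 2) ^ 2 and [Q_list] encodes [eis_poly q], as sums
   of terms x exp (y w), for q = - c exp w. *)
Definition D_list : list (R * R) :=
  [(1, 1 / 12); (2 * c, 13 / 12); (- c ^ 2, 25 / 12); (- (2 * c ^ 3), 37 / 12); (c ^ 4, 49 / 12)].
Definition Q_list : list (R * R) :=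
  [(1, 0); (- (240 * c), 1); (2160 * c ^ 2, 2); (- (6720 * c ^ 3), 3); (17520 * c ^ 4, 4);
   (- (30240 * c ^ 5), 5)].

Definition D_coef (k : nat) : R := nth k (taylor6 (moment D_list)) 0.
Definition Q_coef (k : nat) : R := nth k (taylor6 (moment Q_list)) 0.
(** Up to the truncation of the q-series, [d0] and [d3] are the coefficients of 1 and w ^ 3 in
    [Dfun], and [n1] is that of w in [Qfun]. *)
Definition d0 : R := D_coef 0.
Definition d3 : R := D_coef 3 - b * D_coef 2.
Definition n1 : R := Q_coef 1 - 5 * b * Q_coef 0.

(* [Dfun ^ 12] is Delta (1 - s)^(-12) and [Qfun] is E4 (1 - s)^(-4) times [1 - b w], up to
   constants: hence the absence of w and w ^ 2, and of w ^ 2 and w ^ 3, in their expansions. *)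
Definition Dfun (w : C) : C :=
  ((1 - b * w) * Cexp ((1 / 12)%R * w) * euler (q_of w) ^ 2)%C.
Definition Qfun (w : C) : C := ((1 - b * w) ^ 5 * eis (q_of w))%C.

Lemma Cexp_scal_pow (x y : R) (n : nat) (w : C) : y = x + INR n ->
  (Cexp (x * w) * Cexp w ^ n)%C = Cexp (y * w).
Proof.
  intros ->. rewrite <- Cexp_pow, <- Cexp_plus. f_equal. rewrite RtoC_plus; ring.
Qed.

Lemma D_list_expsum (w : C) :
  (Cexp ((1 / 12)%R * w) * (1 - q_of w - q_of w ^ 2) ^ 2)%C = expsum D_list w.
Proof.
  unfold D_list; cbn [expsum].
  rewrite <- (Cexp_scal_pow (1 / 12) (13 / 12) 1) by (INR_literal; lra).
  rewrite <- (Cexp_scal_pow (1 / 12) (25 / 12) 2) by (INR_literal; lra).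
  rewrite <- (Cexp_scal_pow (1 / 12) (37 / 12) 3) by (INR_literal; lra).
  rewrite <- (Cexp_scal_pow (1 / 12) (49 / 12) 4) by (INR_literal; lra).
  unfold q_of. rewrite !RtoC_opp, !RtoC_mult, !RtoC_pow. ring.
Qed.

Lemma Q_list_expsum (w : C) : eis_poly (q_of w) = expsum Q_list w.
Proof.
  unfold Q_list, eis_poly; cbn [expsum].
  assert (H : forall n : nat, Cexp (INR n * w) = (Cexp w ^ n)%C) by (intros; apply Cexp_pow).
  pose proof (H 0%nat) as H0. pose proof (H 1%nat) as H1. pose proof (H 2%nat) as H2.
  pose proof (H 3%nat) as H3. pose proof (H 4%nat) as H4. pose proof (H 5%nat) as H5.
  rewrite INR_IZR_INZ in H0, H1, H2, H3, H4, H5.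
  cbn [Z.of_nat Pos.of_succ_nat Pos.succ] in H0, H1, H2, H3, H4, H5.
  rewrite H0, H1, H2, H3, H4, H5.
  unfold q_of. rewrite !RtoC_opp, !RtoC_mult, !RtoC_pow. ring.
Qed.

Lemma b_pos : 0 < b.
Proof. enclose_cmp. Qed.

Lemma Cmod_1_sub_b (w : C) (r : R) : Cmod w <= r ->
  1 - b * r <= Cmod (1 - b * w)%C <= 1 + b * r.
Proof.
  intros Hw. pose proof b_pos.
  assert (H0 : Cmod (b * w)%C <= b * r).
  { rewrite Cmod_mult, Cmod_R, Rabs_right by lra. apply Rmult_le_compat_l; lra. }
  split.
  - pose proof (Cmod_triangle (1 - b * w) (b * w)) as H1.
    replace (1 - b * w + b * w)%C with (RtoC 1) in H1 by ring. rewrite Cmod_1 in H1. lra.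
  - eapply Rle_trans; [apply Cmod_triangle|]. rewrite Cmod_opp, Cmod_1. lra.
Qed.

(* The first list bounds the coefficients of the Taylor polynomial of
   [Dfun w - d0 - d3 * (w / (1 - b * w)) ^ 3], which, the last one excepted, would vanish if
   the q-series were not truncated; the last summand accounts for the expansion of
   [(1 - b * w) ^ (-3)]. *)
Definition D_err (r : R) : R :=
  rpoly [0; 1 / 10 ^ 10; 1 / 10 ^ 10; 0; 1 / 10 ^ 10; 1 / 10 ^ 10; 105 / 10 ^ 7] r
  + (1 + b * r) * (expsum_rem D_list r + exp (1 / 12 * r) * (11 / 10 ^ 10))
  + 113 / 10 ^ 5 * r ^ 3 * ((b * r) ^ 3 * (10 + 15 * (b * r) + 6 * (b * r) ^ 2) / (1 - b * r) ^ 3).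

Lemma encl_d3 : encl (11213196540000000000000, 11213196550000000000000)%Z d3.
Proof. unfold d3, D_coef; cbn [taylor6 nth moment D_list]. enclose_cmp. Qed.

Ltac coef_bound :=
  unfold d3, n1, D_coef, Q_coef; cbn [taylor6 nth moment D_list Q_list]; enclose_cmp.

Lemma D_approx (r : R) (w : C) : Cmod w <= r -> r <= 3 / 10 ->
  Cmod (Dfun w - d0 - d3 * (w / (1 - b * w)) ^ 3)%C <= D_err r.
Proof.
  intros Hw Hr. assert (Hr0 : 0 <= r) by (pose proof (Cmod_ge_0 w); lra).
  assert (Hq : Cmod (q_of w) <= q_max) by (apply Cmod_q_of; lra).
  pose proof (Cmod_1_sub_b w r Hw) as [Hb1 Hb2]. pose proof b_pos as Hb.
  assert (Hbr : b * r <= 1 / 10).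
  { apply Rle_trans with (b * (3 / 10)); [apply Rmult_le_compat_l; lra|enclose_cmp]. }
  assert (Hne : (1 - b * w)%C <> 0) by (apply Cmod_gt_0; lra).
  set (v := (b * w)%C) in *.
  assert (Hv : Cmod v <= b * r).
  { unfold v. rewrite Cmod_mult, Cmod_R, Rabs_right by lra. apply Rmult_le_compat_l; lra. }
  set (dl := (euler (q_of w) ^ 2 - (1 - q_of w - q_of w ^ 2) ^ 2)%C).
  set (T := cpoly (taylor6 (moment D_list)) w).
  (* Based on (1 - v) ^ (-3) = 1 + 3 v + 6 v ^ 2 + v ^ 3 (10 - 15 v + 6 v ^ 2) / (1 - v) ^ 3: the
     quadratic part is subtracted coefficientwise, the rest is bounded separately. *)
  set (L := [0; D_coef 1 - b * D_coef 0; D_coef 2 - b * D_coef 1; 0;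
             D_coef 4 - b * D_coef 3 - 3 * b * d3;
             D_coef 5 - b * D_coef 4 - 6 * b ^ 2 * d3; - (b * D_coef 5)]).
  assert (EL : ((1 - v) * T)%C = (cpoly L w + d0 + d3 * w ^ 3 * (1 + 3 * v + 6 * v ^ 2))%C).
  { unfold L, T, d0, d3, v. change (taylor6 (moment D_list))
      with [D_coef 0; D_coef 1; D_coef 2; D_coef 3; D_coef 4; D_coef 5].
    generalize (D_coef 0) (D_coef 1) (D_coef 2) (D_coef 3) (D_coef 4) (D_coef 5).
    intros m0 m1 m2 m3 m4 m5.
    cbn [cpoly].
    rewrite ?RtoC_minus, ?RtoC_opp, ?RtoC_mult, ?RtoC_minus, ?RtoC_mult, ?RtoC_pow. ring. }
  replace (Dfun w - d0 - d3 * (w / (1 - v)) ^ 3)%C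
    with (cpoly L w
          + ((1 - v) * ((expsum D_list w - T) + Cexp ((1 / 12)%R * w) * dl)
          + - (d3 * w ^ 3 * (v ^ 3 * (10 - 15 * v + 6 * v ^ 2) / (1 - v) ^ 3))))%C.
  2:{ replace (cpoly L w)
        with ((1 - v) * T - d0 - d3 * w ^ 3 * (1 + 3 * v + 6 * v ^ 2))%C by (rewrite EL; ring).
      rewrite <- D_list_expsum. unfold Dfun, dl. fold v. field. auto. }
  unfold D_err. rewrite Rplus_assoc.
  eapply Rle_trans; [apply Cmod_triangle|]. apply Rplus_le_compat.
  { apply Cmod_cpoly_le; auto. unfold L.
    repeat apply Forall2_cons; [..|apply Forall2_nil];
      [rewrite Rabs_R0; lra| | |rewrite Rabs_R0; lra| | |]; coef_bound. }
  eapply Rle_trans; [apply Cmod_triangle|]. apply Rplus_le_compat.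
  { rewrite Cmod_mult. apply Rmult_le_compat; auto using Cmod_ge_0.
    eapply Rle_trans; [apply Cmod_triangle|]. apply Rplus_le_compat.
    - apply expsum_taylor6; auto.
    - rewrite Cmod_mult. apply Rmult_le_compat; auto using Cmod_ge_0.
      + eapply Rle_trans; [apply Cmod_Cexp_le|]. apply exp_le.
        rewrite Cmod_mult, Cmod_R, Rabs_right by lra. lra.
      + apply euler_approx; auto. }
  rewrite Cmod_opp, !Cmod_mult, Cmod_R.
  pose proof (Cmod_ge_0 w). pose proof (Cmod_ge_0 v).
  apply Rmult_le_compat.
  - apply Rmult_le_pos; [apply Rabs_pos|apply Cmod_ge_0].
  - apply Cmod_ge_0.
  - apply Rmult_le_compat; [apply Rabs_pos|apply Cmod_ge_0|coef_bound|].
    rewrite Cmod_pow. apply pow_incr; lra.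
  - rewrite Cmod_div by (apply Cpow_nz; auto). rewrite Cmod_mult, !Cmod_pow.
    apply Rmult_le_compat.
    + apply Rmult_le_pos; [apply pow_le; auto|apply Cmod_ge_0].
    + left; apply Rinv_0_lt_compat, pow_lt; lra.
    + apply Rmult_le_compat; [apply pow_le; auto|apply Cmod_ge_0|apply pow_incr; lra|].
      unfold Cminus.
      eapply Rle_trans; [apply Cmod_triangle|].
      eapply Rle_trans; [apply Rplus_le_compat_r, Cmod_triangle|].
      rewrite Cmod_opp, !Cmod_mult, Cmod_pow, !Cmod_R, !Rabs_right by lra.
      assert (Cmod v ^ 2 <= (b * r) ^ 2) by (apply pow_incr; lra). lra.
    + apply Rinv_le_contravar; [apply pow_lt; lra|]. apply pow_incr; lra.
Qed.

(** In the list, the coefficients of 1, w ^ 2 and w ^ 3 are only truncation effects, and that of w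
    has been taken out as [n1]. The one of w ^ 4 is a genuine term of E4 and makes up most of the
    value at the radii used. *)
Definition Q_err (r : R) : R :=
  rpoly [1 / 10 ^ 8; 0; 1 / 10 ^ 8; 2 / 10 ^ 8; 801 / 10 ^ 5; 221 / 10 ^ 5; 13 / 10 ^ 4;
         2 / 10 ^ 4; 2 / 10 ^ 5; 1 / 10 ^ 6; 1 / 10 ^ 7] r
  + (1 + b * r) ^ 5 * (expsum_rem Q_list r + 2 / 10 ^ 7).

Lemma Q_approx (r : R) (w : C) : Cmod w <= r -> r <= 3 / 10 ->
  Cmod (Qfun w - n1 * w)%C <= Q_err r.
Proof.
  intros Hw Hr. assert (Hr0 : 0 <= r) by (pose proof (Cmod_ge_0 w); lra).
  assert (Hq : Cmod (q_of w) <= q_max) by (apply Cmod_q_of; lra).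
  pose proof (Cmod_1_sub_b w r Hw) as [Hb1 Hb2]. pose proof b_pos as Hb.
  set (T := cpoly (taylor6 (moment Q_list)) w).
  set (L := [Q_coef 0; 0; Q_coef 2 - 5 * b * Q_coef 1 + 10 * b ^ 2 * Q_coef 0;
             Q_coef 3 - 5 * b * Q_coef 2 + 10 * b ^ 2 * Q_coef 1 - 10 * b ^ 3 * Q_coef 0;
             Q_coef 4 - 5 * b * Q_coef 3 + 10 * b ^ 2 * Q_coef 2 - 10 * b ^ 3 * Q_coef 1
               + 5 * b ^ 4 * Q_coef 0;
             Q_coef 5 - 5 * b * Q_coef 4 + 10 * b ^ 2 * Q_coef 3 - 10 * b ^ 3 * Q_coef 2
               + 5 * b ^ 4 * Q_coef 1 - b ^ 5 * Q_coef 0;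
             10 * b ^ 2 * Q_coef 4 - 5 * b * Q_coef 5 - 10 * b ^ 3 * Q_coef 3
               + 5 * b ^ 4 * Q_coef 2 - b ^ 5 * Q_coef 1;
             10 * b ^ 2 * Q_coef 5 - 10 * b ^ 3 * Q_coef 4
               + 5 * b ^ 4 * Q_coef 3 - b ^ 5 * Q_coef 2;
             5 * b ^ 4 * Q_coef 4 - 10 * b ^ 3 * Q_coef 5 - b ^ 5 * Q_coef 3;
             5 * b ^ 4 * Q_coef 5 - b ^ 5 * Q_coef 4;
             - (b ^ 5 * Q_coef 5)]).
  assert (EL : ((1 - b * w) ^ 5 * T)%C = (cpoly L w + n1 * w)%C).
  { unfold L, T, n1. change (taylor6 (moment Q_list))
      with [Q_coef 0; Q_coef 1; Q_coef 2; Q_coef 3; Q_coef 4; Q_coef 5].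
    generalize (Q_coef 0) (Q_coef 1) (Q_coef 2) (Q_coef 3) (Q_coef 4) (Q_coef 5).
    intros m0 m1 m2 m3 m4 m5.
    cbn [cpoly].
    repeat (rewrite ?RtoC_minus, ?RtoC_plus, ?RtoC_opp, ?RtoC_mult, ?RtoC_pow). ring. }
  replace (Qfun w - n1 * w)%C
    with (cpoly L w + (1 - b * w) ^ 5
          * ((expsum Q_list w - T) + (eis (q_of w) - eis_poly (q_of w))))%C.
  2:{ replace (cpoly L w) with ((1 - b * w) ^ 5 * T - n1 * w)%C by (rewrite EL; ring).
      rewrite <- Q_list_expsum. unfold Qfun. ring. }
  unfold Q_err.
  eapply Rle_trans; [apply Cmod_triangle|]. apply Rplus_le_compat.
  { apply Cmod_cpoly_le; auto. unfold L.
    repeat apply Forall2_cons; [..|apply Forall2_nil];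
      [|rewrite Rabs_R0; lra|..]; coef_bound. }
  rewrite Cmod_mult, Cmod_pow. apply Rmult_le_compat; auto using Cmod_ge_0.
  - apply pow_le, Cmod_ge_0.
  - apply pow_incr; split; auto using Cmod_ge_0.
  - eapply Rle_trans; [apply Cmod_triangle|]. apply Rplus_le_compat.
    + apply expsum_taylor6; auto.
    + apply eis_approx; auto.
Qed.

Lemma D_err_bounds : D_err (3 / 10) <= 1 / 10 ^ 7 /\ D_err (179 / 1000) <= 3 / 10 ^ 9.
Proof. unfold D_err; cbn [rpoly expsum_rem D_list]. enclose_cmp. Qed.

Lemma Q_err_bounds : Q_err (3 / 10) <= 1 / 10 ^ 4 /\ Q_err (179 / 1000) <= 93 / 10 ^ 7.
Proof. unfold Q_err; cbn [rpoly expsum_rem Q_list]. enclose_cmp. Qed.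

(** * Size of the solution *)

Lemma encl_gamma0 :
  encl (39567285192900000000000000, 39567285193000000000000000)%Z gamma0.
Proof. unfold gamma0. enclose_cmp. Qed.

Lemma encl_d0 : encl (10086479000880000000000000, 10086479000890000000000000)%Z d0.
Proof. unfold d0, D_coef; cbn [taylor6 nth moment D_list]. enclose_cmp. Qed.

Lemma encl_n1 : encl (-9605137024690000000000000, -9605137024640000000000000)%Z n1.
Proof. unfold n1, Q_coef; cbn [taylor6 nth moment Q_list]. enclose_cmp. Qed.
#[local] Hint Resolve encl_gamma0 encl_d0 encl_n1 encl_d3 : encl.

Lemma gamma0_pos : 0 < gamma0.
Proof. enclose_cmp. Qed.

Lemma d0_pos : 0 < d0.
Proof. enclose_cmp. Qed.

Lemma n1_neg : n1 < 0.
Proof. enclose_cmp. Qed.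

Lemma t6_pos : 0 < t6.
Proof. apply exp_pos. Qed.

Lemma Cmod_disc_sub (v : C) (r : R) : Cmod v <= r -> 1 - r <= Cmod (1 + v)%C.
Proof.
  intros Hv. pose proof (Cmod_triangle (1 + v) (- v)) as H.
  replace (1 + v + - v)%C with (RtoC 1) in H by ring.
  rewrite Cmod_1, Cmod_opp in H. lra.
Qed.

Lemma euler_neq0 (q : C) : Cmod q <= q_max -> euler q <> 0.
Proof.
  intros Hq. apply Cmod_gt_0. pose proof (euler_sub_1 q Hq).
  pose proof (Cmod_disc_sub (euler q - 1) (1 / 2)) as H1.
  replace (1 + (euler q - 1))%C with (euler q) in H1 by ring.
  enough (1 - 1 / 2 <= Cmod (euler q)) by lra. apply H1.
  unfold q_max in *; lra.
Qed.

Lemma Cexp_cancel (x y : R) (w : C) : x + y = 0 -> (Cexp (x * w) * Cexp (y * w))%C = 1.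
Proof.
  intros H. rewrite <- Cexp_plus, <- Cmult_plus_distr_r, <- RtoC_plus, H, Cmult_0_l.
  apply Cexp_0.
Qed.

Lemma Cexp_12_pow4 (w : C) : (Cexp ((1 / 12)%R * w) ^ 4)%C = Cexp ((1 / 3)%R * w).
Proof.
  rewrite <- Cexp_pow, Cmult_assoc, <- RtoC_mult. do 3 f_equal.
  INR_literal. field.
Qed.

Lemma eis_of_root (u w : C) : j_eq u w = 0 ->
  eis (q_of w) = (- (u * t6 ^ 2 * Cexp ((1 / 3)%R * w) * euler (q_of w) ^ 8))%C.
Proof.
  intros E. unfold j_eq in E.
  pose proof (Cexp_cancel (1 / 3) (- (1 / 3)) w ltac:(ring)) as H.
  set (e := Cexp ((1 / 3)%R * w)) in *. set (e' := Cexp ((- (1 / 3))%R * w)) in *.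
  replace (eis (q_of w)) with (e * e' * eis (q_of w))%C by (rewrite H; ring).
  replace (e * e' * eis (q_of w))%C
    with (e * (e' * eis (q_of w) + u * t6 ^ 2 * euler (q_of w) ^ 8)
          - u * t6 ^ 2 * e * euler (q_of w) ^ 8)%C by ring.
  rewrite E; ring.
Qed.

(** The equation in terms of the two functions whose expansions are known. To first order it reads
    n1 w = - u t6 ^ 2 (1 - b w) d0 ^ 4, that is w / (1 - b w) = u S0. *)
Lemma Qfun_of_root (u w : C) : j_eq u w = 0 ->
  Qfun w = (- (u * t6 ^ 2 * (1 - b * w) * Dfun w ^ 4))%C.
Proof.
  intros E. unfold Qfun, Dfun. rewrite (eis_of_root u w E), <- Cexp_12_pow4.
  rewrite !Cpow_mult_l. ring.
Qed.

(* [b * S0] is an approximation of [/ gamma0 ^ 3]. *)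
Definition S0 : R := t6 ^ 2 * d0 ^ 4 / - n1.

Lemma encl_S0 : encl (1756838073000000000000000, 1756838075000000000000000)%Z S0.
Proof.
  unfold S0. replace (t6 ^ 2 * d0 ^ 4 / - n1) with (t6 ^ 2 * d0 ^ 4 / (0 - n1)) by (f_equal; ring).
  enclose_cmp.
Qed.
#[local] Hint Resolve encl_S0 : encl.

Definition Zfun (w : C) : C := (Dfun w / d0 - 1)%C.

Lemma Zfun_approx (r e : R) (w : C) : Cmod w <= r -> r <= 3 / 10 -> D_err r <= e ->
  Cmod (Zfun w - (d3 / d0)%R * (w / (1 - b * w)) ^ 3)%C <= e / d0.
Proof.
  intros Hw Hr He. pose proof (D_approx r w Hw Hr) as H. pose proof d0_pos as Hd.
  assert (Hd' : RtoC d0 <> 0) by (apply RtoC_neq; lra).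
  set (X := (w / (1 - b * w))%C) in *.
  replace (Zfun w - (d3 / d0)%R * X ^ 3)%C with ((Dfun w - d0 - d3 * X ^ 3) / d0)%C.
  - rewrite Cmod_div, Cmod_R, (Rabs_right d0) by (auto; lra).
    apply Rmult_le_compat_r; [left; apply Rinv_0_lt_compat; auto|lra].
  - unfold Zfun. rewrite RtoC_div by lra. field; auto.
Qed.

(** With z = [Zfun w], the equation divided by n1 (1 - b w) says that w / (1 - b w) is u S0 (1 + z)
    ^ 4 up to the error of [Q_approx], and (1 + z) ^ 4 - 1 = z (4 + 6 z + 4 z ^ 2 + z ^ 3). *)
Lemma X_approx (u w : C) (r Z e : R) : Cmod u = 1 -> j_eq u w = 0 ->
  Cmod w <= r -> r <= 3 / 10 -> Cmod (Zfun w) <= Z -> Q_err r <= e ->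
  Cmod (w / (1 - b * w) - u * S0)%C
    <= S0 * (Z * (4 + 6 * Z + 4 * Z ^ 2 + Z ^ 3)) + e / (- n1 * (1 - b * r)).
Proof.
  intros Hu E Hw Hr HZ He.
  pose proof (Cmod_1_sub_b w r Hw) as [Hb1 Hb2]. pose proof b_pos as Hb.
  pose proof d0_pos as Hd. pose proof n1_neg as Hn.
  assert (Hbr : b * r <= 1 / 10).
  { apply Rle_trans with (b * (3 / 10)); [apply Rmult_le_compat_l; lra|enclose_cmp]. }
  assert (Hne : (1 - b * w)%C <> 0) by (apply Cmod_gt_0; lra).
  assert (Hd' : RtoC d0 <> 0) by (apply RtoC_neq; lra).
  assert (Hn' : RtoC n1 <> 0) by (apply RtoC_neq; lra).
  pose proof (Q_approx r w Hw Hr) as HQ. rewrite (Qfun_of_root u w E) in HQ.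
  set (z := Zfun w) in *.
  assert (ED : Dfun w = (d0 * (1 + z))%C) by (unfold z, Zfun; field; auto).
  rewrite ED in HQ.
  set (dQ := (- (u * t6 ^ 2 * (1 - b * w) * (d0 * (1 + z)) ^ 4) - n1 * w)%C) in *.
  replace (w / (1 - b * w) - u * S0)%C
    with (u * S0 * (z * (4 + 6 * z + 4 * z ^ 2 + z ^ 3)) + - (dQ / (n1 * (1 - b * w))))%C.
  2:{ unfold dQ, S0. rewrite RtoC_div, RtoC_opp, RtoC_mult, !RtoC_pow by lra. field; auto. }
  assert (HS : 0 <= S0) by enclose_cmp.
  pose proof (Cmod_ge_0 z).
  eapply Rle_trans; [apply Cmod_triangle|]. apply Rplus_le_compat.
  - rewrite !Cmod_mult, Hu, Cmod_R, Rabs_right, Rmult_1_l by lra.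
    apply Rmult_le_compat_l; auto.
    apply Rmult_le_compat; auto using Cmod_ge_0.
    eapply Rle_trans; [apply Cmod_triangle|].
    eapply Rle_trans; [apply Rplus_le_compat_r, Cmod_triangle|].
    eapply Rle_trans; [apply Rplus_le_compat_r, Rplus_le_compat_r, Cmod_triangle|].
    rewrite !Cmod_mult, !Cmod_pow, !Cmod_R, !Rabs_right by lra.
    assert (Cmod z ^ 2 <= Z ^ 2) by (apply pow_incr; lra).
    assert (Cmod z ^ 3 <= Z ^ 3) by (apply pow_incr; lra). lra.
  - rewrite Cmod_opp, Cmod_div by (apply Cmult_neq_0; auto).
    rewrite Cmod_mult, Cmod_R, Rabs_left by lra.
    apply Rmult_le_compat; auto using Cmod_ge_0.
    + left; apply Rinv_0_lt_compat. nra.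
    + lra.
    + apply Rinv_le_contravar; [nra|]. apply Rmult_le_compat_l; lra.
Qed.

(** The inverse substitution is w = X / (1 + b X). *)
Lemma Cmod_w_of_X (w : C) (y : R) : (1 - b * w)%C <> 0 -> b * y < 1 ->
  Cmod (w / (1 - b * w))%C <= y -> Cmod w <= y / (1 - b * y).
Proof.
  intros Hne Hy HX. pose proof b_pos as Hb.
  set (X := (w / (1 - b * w))%C) in *.
  assert (HbX : Cmod (b * X)%C <= b * y).
  { rewrite Cmod_mult, Cmod_R, Rabs_right by lra. apply Rmult_le_compat_l; lra. }
  pose proof (Cmod_disc_sub (b * X) (b * y) HbX) as H1.
  assert (E : (w * (1 + b * X))%C = X) by (unfold X; field; auto).
  assert (H2 : Cmod w * Cmod (1 + b * X)%C <= y) by (rewrite <- Cmod_mult, E; auto).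
  apply Rmult_le_reg_r with (1 - b * y); [lra|].
  unfold Rdiv. rewrite Rmult_assoc, Rinv_l, Rmult_1_r by lra.
  pose proof (Cmod_ge_0 w). nra.
Qed.

Lemma root_estimates (u w : C) : Cmod u = 1 -> Cmod w <= 3 / 10 -> j_eq u w = 0 ->
  Cmod (w / (1 - b * w) - u * S0)%C <= 142 / 10 ^ 7 /\
  Cmod (Zfun w) <= 61 / 10 ^ 7 /\
  Cmod (Zfun w - (d3 / d0)%R * (w / (1 - b * w)) ^ 3)%C <= 3 / 10 ^ 9 / d0.
Proof.
  intros Hu Hw E. set (X := (w / (1 - b * w))%C).
  pose proof b_pos as Hb. pose proof d0_pos as Hd.
  pose proof D_err_bounds as [De1 De2]. pose proof Q_err_bounds as [Qe1 Qe2].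
  pose proof (Cmod_1_sub_b w _ Hw) as [Hb1 _].
  assert (Hb3 : 97 / 100 <= 1 - b * (3 / 10)) by enclose_cmp.
  assert (Hne : (1 - b * w)%C <> 0) by (apply Cmod_gt_0; lra).
  assert (Hk : 0 <= d3 / d0) by enclose_cmp.
  (* Bounds for X and [Zfun w] improve each other: this passes from X to [Zfun w], and [X_approx]
     goes back. *)
  assert (HZ : forall y e, Cmod X <= y -> Cmod (Zfun w - (d3 / d0)%R * X ^ 3)%C <= e ->
             Cmod (Zfun w) <= d3 / d0 * y ^ 3 + e).
  { intros y e Hy He.
    replace (Zfun w) with ((d3 / d0)%R * X ^ 3 + (Zfun w - (d3 / d0)%R * X ^ 3))%C by ring.
    eapply Rle_trans; [apply Cmod_triangle|]. apply Rplus_le_compat; auto.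
    rewrite Cmod_mult, Cmod_R, Rabs_right, Cmod_pow by lra.
    apply Rmult_le_compat_l; auto. apply pow_incr; split; auto using Cmod_ge_0. }
  assert (HuS : Cmod (u * S0)%C = S0).
  { rewrite Cmod_mult, Hu, Cmod_R, Rabs_right, Rmult_1_l; auto. enclose_cmp. }
  assert (HX : forall e, Cmod (X - u * S0)%C <= e -> Cmod X <= S0 + e).
  { intros e He. replace X with (u * S0 + (X - u * S0))%C by ring.
    eapply Rle_trans; [apply Cmod_triangle|]. lra. }
  (* A first round of estimates on the disc of radius 3/10 confines [w] to radius 0.179, where
     a second round is precise enough. *)
  assert (X1 : Cmod X <= 31 / 100).
  { unfold X. rewrite Cmod_div by auto. apply Rle_trans with (3 / 10 * / (97 / 100)); [|lra].
    apply Rmult_le_compat; auto using Cmod_ge_0.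
    - left; apply Rinv_0_lt_compat; lra.
    - apply Rinv_le_contravar; lra. }
  assert (Z1 : Cmod (Zfun w) <= 4 / 10 ^ 5).
  { eapply Rle_trans; [apply (HZ _ _ X1 (Zfun_approx _ _ w Hw ltac:(lra) De1))|].
    enclose_cmp. }
  assert (X2 : Cmod X <= S0 + 15 / 10 ^ 5).
  { apply HX. eapply Rle_trans; [apply (X_approx u w _ _ _ Hu E Hw ltac:(lra) Z1 Qe1)|].
    replace (- n1) with (0 - n1) by ring. enclose_cmp. }
  assert (W2 : Cmod w <= 179 / 1000).
  { eapply Rle_trans; [apply (Cmod_w_of_X w (S0 + 15 / 10 ^ 5) Hne); auto; enclose_cmp|].
    enclose_cmp. }
  pose proof (Zfun_approx _ _ w W2 ltac:(lra) De2) as Z2. fold X in Z2.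
  assert (Z3 : Cmod (Zfun w) <= 61 / 10 ^ 7).
  { eapply Rle_trans; [apply (HZ _ _ X2 Z2)|]. enclose_cmp. }
  split; [|split]; auto.
  eapply Rle_trans; [apply (X_approx u w _ _ _ Hu E W2 ltac:(lra) Z3 Qe2)|].
  replace (- n1) with (0 - n1) by ring. enclose_cmp.
Qed.

(** * The Green function *)

Lemma ln_le_sub_1 (x : R) : 0 < x -> ln x <= x - 1.
Proof.
  intros Hx. pose proof (exp_ineq1_le (ln x)). rewrite exp_ln in H by auto. lra.
Qed.

Lemma ln_sub_bound (x y m e : R) : 0 < m -> m <= x -> m <= y -> Rabs (x - y) <= e ->
  Rabs (ln x - ln y) <= e / m.
Proof.
  intros Hm Hx Hy He. apply Rabs_le_between in He.
  assert (H : forall u v, m <= u -> m <= v -> u - v <= e -> ln u - ln v <= e / m).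
  { intros u v Hu Hv Huv.
    rewrite <- ln_div by lra.
    eapply Rle_trans; [apply ln_le_sub_1; apply Rdiv_lt_0_compat; lra|].
    replace (u / v - 1) with ((u - v) / v) by (field; lra).
    destruct (Rle_lt_dec 0 (u - v)) as [Hs|Hs].
    - apply Rmult_le_compat; try lra.
      + left; apply Rinv_0_lt_compat; lra.
      + apply Rinv_le_contravar; lra.
    - apply Rle_trans with 0.
      + apply Rmult_le_0_r; [lra|left; apply Rinv_0_lt_compat; lra].
      + apply Rmult_le_pos; [lra|left; apply Rinv_0_lt_compat; lra]. }
  apply Rabs_le; split.
  - pose proof (H y x Hy Hx). lra.
  - apply H; lra.
Qed.

(** 2 ln |1 + z| = ln (1 + h) with h = 2 Re z + |z| ^ 2; the inequality ln x <= x - 1 at 1 + h and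
    at its inverse bounds this on both sides. *)
Lemma ln_Cmod_1_add (z : C) : Cmod z <= 1 / 10 ->
  Rabs (ln (Cmod (1 + z)%C) - Re z) <= 4 * Cmod z ^ 2.
Proof.
  intros Hz. pose proof (Cmod_ge_0 z) as H0.
  pose proof (Cmod_disc_sub z _ Hz) as H1.
  set (h := 2 * Re z + Cmod z ^ 2).
  assert (E : Cmod (1 + z)%C ^ 2 = 1 + h).
  { unfold h. rewrite !Cmod2_alt. unfold Re, Im; cbn [Cplus RtoC fst snd]. ring. }
  assert (El : 2 * ln (Cmod (1 + z)%C) = ln (1 + h)).
  { rewrite <- E. replace 2 with (INR 2) at 1 by (cbn; ring). rewrite <- ln_pow by lra. auto. }
  assert (Hh : Rabs h <= 21 / 10 * Cmod z).
  { unfold h. pose proof (re_le_Cmod z) as Hr. apply Rabs_le_between in Hr.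
    apply Rabs_le. split; nra. }
  apply Rabs_le_between in Hh.
  assert (Hp : 0 < 1 + h) by lra.
  pose proof (ln_le_sub_1 (1 + h) Hp) as Hu.
  pose proof (ln_le_sub_1 (/ (1 + h)) ltac:(apply Rinv_0_lt_compat; auto)) as Hl.
  rewrite ln_Rinv in Hl by auto.
  assert (Hi : / (1 + h) - 1 <= - h + 2 * h ^ 2).
  { replace (/ (1 + h) - 1) with (- h + h ^ 2 / (1 + h)) by (field; lra).
    apply Rplus_le_compat_l. unfold Rdiv. rewrite Rmult_comm.
    apply Rmult_le_compat_r; [apply pow2_ge_0|].
    replace 2 with (/ (1 / 2)) by field. apply Rinv_le_contravar; lra. }
  assert (Hh2 : h ^ 2 <= (21 / 10 * Cmod z) ^ 2).
  { rewrite <- (pow2_abs h). apply pow_incr; split; [apply Rabs_pos|apply Rabs_le; lra]. }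
  unfold h in *. apply Rabs_le; split; nra.
Qed.

Lemma unit_circle_cube_root (zeta : C) : Cmod zeta = 1 ->
  exists u, Cmod u = 1 /\ (u ^ 3)%C = zeta.
Proof.
  intros Hz.
  assert (E : Re zeta ^ 2 + Im zeta ^ 2 = 1) by (rewrite <- Cmod2_alt, Hz; ring).
  assert (Hth : exists th, Re zeta = cos th /\ Im zeta = sin th).
  { assert (Hr : -1 <= Re zeta <= 1) by (split; nra).
    assert (Hs : Rabs (Im zeta) = sin (acos (Re zeta))).
    { rewrite sin_acos by auto. rewrite <- sqrt_Rsqr_abs. f_equal. unfold Rsqr; nra. }
    destruct (Rle_lt_dec 0 (Im zeta)) as [Hi|Hi].
    - exists (acos (Re zeta)). rewrite cos_acos by auto. rewrite Rabs_right in Hs by lra. auto.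
    - exists (- acos (Re zeta)). rewrite cos_neg, sin_neg, cos_acos, <- Hs by auto.
      rewrite Rabs_left by lra. split; ring. }
  destruct Hth as [th [H1 H2]].
  exists (Cexp (0%R, (th / 3)%R)). split.
  - rewrite Cmod_Cexp. cbn. apply exp_0.
  - rewrite <- Cexp_pow. unfold Cexp.
    replace (INR 3 * (0%R, (th / 3)%R))%C with ((0%R, th) : C).
    + cbn. rewrite exp_0, !Rmult_1_l, <- H1, <- H2. destruct zeta; reflexivity.
    + rewrite INR_IZR_INZ. unfold Cmult, RtoC; cbn [fst snd Z.of_nat Pos.of_succ_nat Pos.succ].
      f_equal; field.
Qed.

(* The solution of w = 2 pi i (tau - rho). *)
Definition tau_of (w : C) : C :=
  (1 / 2 + Im w / (2 * PI), sqrt 3 / 2 - Re w / (2 * PI)).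

Lemma nome_tau_of (w : C) : nome (tau_of w) = q_of w.
Proof.
  pose proof PI_RGT_0 as HP.
  unfold nome.
  (* 2 pi i rho = - height + i pi. *)
  replace (2 * PI * Ci * tau_of w)%C with (((- height)%R, PI) + w)%C.
  - rewrite Cexp_plus. unfold q_of. f_equal.
    unfold Cexp, Re, Im; cbn [fst snd]. rewrite cos_PI, sin_PI.
    unfold Copp, RtoC; cbn [fst snd]. fold c. f_equal; ring.
  - destruct w as [x y]. unfold tau_of, Ci, RtoC, Cmult, Cplus, Re, Im, height; cbn [fst snd].
    f_equal; field; lra.
Qed.

Lemma Im_tau_of (w : C) : 4 * PI * Im (tau_of w) = 2 * height * (1 - 2 * b * Re w).
Proof.
  assert (Hp : 0 < PI) by enclose_cmp. assert (Hs : 0 < sqrt 3) by enclose_cmp.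
  unfold tau_of, Im, b, height; cbn [fst snd]. field. lra.
Qed.

Lemma j_inv_of_root (u w : C) : Cmod w <= 3 / 10 -> j_eq u w = 0 ->
  j_inv (tau_of w) = (u ^ 3)%C.
Proof.
  intros Hw E. pose proof (Cmod_q_of w Hw) as Hq.
  assert (Hq' : Cmod (nome (tau_of w)) <= q_max) by (rewrite nome_tau_of; auto).
  unfold j_inv. rewrite E4_eis, (modular_Delta_euler q_max) by (auto; unfold q_max; lra).
  rewrite nome_tau_of, (eis_of_root u w E).
  pose proof (euler_neq0 _ Hq) as He. pose proof (Cexp_neq0 w) as Hw0.
  assert (Hc : RtoC c <> 0) by (apply RtoC_neq; pose proof c_pos; lra).
  assert (H3 : (Cexp ((1 / 3)%R * w) ^ 3)%C = Cexp w).
  { rewrite <- Cexp_pow, Cmult_assoc, <- RtoC_mult. f_equal.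
    replace (INR 3 * (1 / 3)) with 1 by (INR_literal; field).
    ring. }
  assert (Ht : (t6 ^ 6)%C = c) by (rewrite c_t6, RtoC_pow; auto).
  set (P := euler (q_of w)) in *. unfold q_of.
  set (y := Cexp ((1 / 3)%R * w)) in *.
  (* The minus sign survives the cube and matches the one in [q_of w] = - c exp w, so that the
     quotient is + u ^ 3. *)
  replace ((- (u * t6 ^ 2 * y * P ^ 8)) ^ 3)%C with (- (u ^ 3 * t6 ^ 6 * y ^ 3 * P ^ 24))%C by ring.
  rewrite H3, Ht. field. auto.
Qed.

(** Im tau is proportional to 1 - 2 b Re w = |1 - b w| ^ 2 (1 - |s| ^ 2) with s = - b w / (1 - b w).
    In the sixth power, the factor |1 - b w| ^ 12 is the one that [Dfun ^ 12] absorbs. *)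
Lemma g_infty_of_root (w : C) : Cmod w <= 3 / 10 ->
  0 < Im (tau_of w) ->
  0 < 1 - b ^ 2 * Cmod (w / (1 - b * w))%C ^ 2 ->
  0 < Cmod (1 + Zfun w)%C ->
  g_infty (tau_of w) =
    - (6 * ln (2 * height) + 6 * ln (1 - b ^ 2 * Cmod (w / (1 - b * w))%C ^ 2)
       + 6 * ln t6 + 12 * ln d0 + 12 * ln (Cmod (1 + Zfun w)%C)).
Proof.
  intros Hw Him Hs HZ.
  pose proof (Cmod_q_of w Hw) as Hq.
  assert (Hq' : Cmod (nome (tau_of w)) <= q_max) by (rewrite nome_tau_of; auto).
  pose proof d0_pos as Hd. pose proof t6_pos as Ht.
  assert (Hh : 0 < height) by enclose_cmp.
  pose proof (Cmod_1_sub_b w _ Hw) as [Hb1 _].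
  assert (Hb3 : 97 / 100 <= 1 - b * (3 / 10)) by enclose_cmp.
  assert (Hne : (1 - b * w)%C <> 0) by (apply Cmod_gt_0; lra).
  set (m := Cmod (1 - b * w)%C) in *.
  set (s := 1 - b ^ 2 * Cmod (w / (1 - b * w))%C ^ 2) in *.
  assert (Es : 1 - 2 * b * Re w = m ^ 2 * s).
  { unfold s. rewrite Cmod_div by auto. fold m.
    replace (m ^ 2 * (1 - b ^ 2 * (Cmod w / m) ^ 2)) with (m ^ 2 - b ^ 2 * Cmod w ^ 2)
      by (field; lra).
    unfold m. rewrite !Cmod2_alt. destruct w as [x y].
    unfold Re, Im, Cminus, Cplus, Copp, Cmult, RtoC; cbn [fst snd]. ring. }
  set (P := Cmod (euler (q_of w))).
  assert (ED : d0 * Cmod (1 + Zfun w)%C = m * exp (1 / 12 * Re w) * P ^ 2).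
  { replace (d0 * Cmod (1 + Zfun w)%C) with (Cmod (d0 * (1 + Zfun w))%C)
      by (rewrite Cmod_mult, Cmod_R, Rabs_right; lra).
    replace (d0 * (1 + Zfun w))%C with (Dfun w).
    - unfold Dfun, P. rewrite !Cmod_mult, Cmod_Cexp, Cmod_pow. fold m. do 3 f_equal.
      unfold Re; cbn; ring.
    - unfold Zfun. field. apply RtoC_neq; lra. }
  assert (EM : (4 * PI * Im (tau_of w)) ^ 6 * Cmod (modular_Delta (tau_of w))
      = (2 * height * s * t6) ^ 6 * (d0 * Cmod (1 + Zfun w)%C) ^ 12).
  { rewrite Im_tau_of, Es, ED, (modular_Delta_euler q_max) by (auto; unfold q_max; lra).
    rewrite nome_tau_of, Cmod_mult, Cmod_pow. fold P. unfold q_of.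
    rewrite Cmod_mult, Cmod_opp, Cmod_R, Rabs_right, Cmod_Cexp, c_t6
      by (left; apply c_pos).
    replace (exp (Re w)) with (exp (1 / 12 * Re w) ^ 12).
    - ring.
    - rewrite <- exp_mult_nat. f_equal. INR_literal. field. }
  unfold g_infty. rewrite EM.
  assert (0 < 2 * height * s) by (apply Rmult_lt_0_compat; lra).
  assert (0 < 2 * height * s * t6) by (apply Rmult_lt_0_compat; auto).
  assert (0 < d0 * Cmod (1 + Zfun w)%C) by (apply Rmult_lt_0_compat; auto).
  rewrite ln_mult, !ln_pow by (auto using pow_lt).
  rewrite (ln_mult (2 * height * s) t6), (ln_mult (2 * height) s), (ln_mult d0) by lra.
  rewrite (INR_IZR_INZ 6), (INR_IZR_INZ 12). cbn [Z.of_nat Pos.of_succ_nat Pos.succ]. ring.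
Qed.

(** Brings out 1 - gamma0 ^ (-6), the counterpart of 1 - |s| ^ 2 on the circle |j| = 1. *)
Lemma gamma1_eq : gamma1 = 3 * ln 192 - 18 * ln gamma0 - 6 * ln (1 - / gamma0 ^ 6).
Proof.
  pose proof gamma0_pos as Hg.
  assert (H1 : 0 < 1 - / gamma0 ^ 6) by enclose_cmp.
  unfold gamma1.
  replace (gamma0 ^ 3 - / gamma0 ^ 3) with (gamma0 ^ 3 * (1 - / gamma0 ^ 6)) by (field; lra).
  rewrite ln_mult, ln_pow by (auto using pow_lt).
  INR_literal. ring.
Qed.

(** A third of the sum is ln x - ln y for two numbers near 3837 that agree within 10 ^ (-6);
    dividing by a common lower bound spares any enclosure of logarithms. *)
Lemma constant_term :
  Rabs (6 * ln (2 * height) + 6 * ln t6 + 12 * ln d0 + 3 * ln 192 - 18 * ln gamma0)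
    <= 1 / 10 ^ 8.
Proof.
  pose proof gamma0_pos as Hg. pose proof d0_pos as Hd. pose proof t6_pos as Ht.
  assert (Hh : 0 < 2 * height) by enclose_cmp.
  set (x := (2 * height) ^ 2 * t6 ^ 2 * d0 ^ 4 * 192). set (y := gamma0 ^ 6).
  replace (6 * ln (2 * height) + 6 * ln t6 + 12 * ln d0 + 3 * ln 192 - 18 * ln gamma0)
    with (3 * (ln x - ln y)).
  - assert (H : Rabs (ln x - ln y) <= 1 / 10 ^ 6 / 1000).
    { apply ln_sub_bound; unfold x, y; [lra|enclose_cmp..]. }
    rewrite Rabs_mult, (Rabs_right 3) by lra. lra.
  - unfold x, y.
    pose proof (pow_lt _ 2 Hh). pose proof (pow_lt _ 2 Ht). pose proof (pow_lt _ 4 Hd).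
    assert (0 < (2 * height) ^ 2 * t6 ^ 2) by (apply Rmult_lt_0_compat; auto).
    assert (0 < (2 * height) ^ 2 * t6 ^ 2 * d0 ^ 4) by (apply Rmult_lt_0_compat; auto).
    rewrite (ln_mult _ 192), (ln_mult _ (d0 ^ 4)), (ln_mult _ (t6 ^ 2)), !ln_pow
      by (auto; lra).
    INR_literal. ring.
Qed.

Lemma cube_sub_bound (x y : C) (s e : R) : Cmod y = s -> Cmod (x - y)%C <= e ->
  Cmod (x ^ 3 - y ^ 3)%C <= e * (3 * (s + e) ^ 2).
Proof.
  intros Hy He.
  assert (Hx : Cmod x <= s + e).
  { replace x with (y + (x - y))%C by ring. eapply Rle_trans; [apply Cmod_triangle|]. lra. }
  pose proof (Cmod_ge_0 x). pose proof (Cmod_ge_0 y). pose proof (Cmod_ge_0 (x - y)).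
  replace (x ^ 3 - y ^ 3)%C with ((x - y) * (x * x + x * y + y * y))%C by ring.
  rewrite Cmod_mult. apply Rmult_le_compat; auto using Cmod_ge_0.
  eapply Rle_trans; [apply Cmod_triangle|].
  eapply Rle_trans; [apply Rplus_le_compat_r, Cmod_triangle|].
  rewrite !Cmod_mult. nra.
Qed.

Theorem propositionB (g_hyp : C -> R)
  (Hg : forall tau : C, 0 < Im tau -> g_infty tau = g_hyp (j_inv tau))
  (zeta : C) (Hzeta : Cmod zeta = 1) :
  Rabs (g_hyp zeta - (gamma1 - Re zeta / 13824)) <= 5 / 10 ^ 7.
Proof.
  destruct (unit_circle_cube_root zeta Hzeta) as [u [Hu Eu]].
  destruct (j_eq_root u Hu) as [w [Hw E]].
  destruct (root_estimates u w Hu Hw E) as [HX [HZ HZX]].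
  set (X := (w / (1 - b * w))%C) in *. set (z := Zfun w) in *.
  pose proof gamma0_pos as Hg0. pose proof d0_pos as Hd.
  assert (Him : 0 < Im (tau_of w)).
  { pose proof PI_RGT_0. pose proof b_pos. pose proof (Re_le_Cmod w).
    assert (0 < 2 * height) by enclose_cmp. assert (b * (6 / 10) <= 1 / 2) by enclose_cmp.
    assert (0 < 4 * PI * Im (tau_of w)).
    { rewrite Im_tau_of. apply Rmult_lt_0_compat; auto. nra. }
    nra. }
  assert (HuS : Cmod (u * S0)%C = S0).
  { rewrite Cmod_mult, Hu, Cmod_R, Rabs_right, Rmult_1_l; auto. enclose_cmp. }
  assert (HXS : Rabs (Cmod X - S0) <= 142 / 10 ^ 7).
  { rewrite <- HuS. apply Rabs_le. split.
    - pose proof (Cmod_triangle X (- (X - u * S0))) as H.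
      replace (X + - (X - u * S0))%C with (u * S0)%C in H by ring. rewrite Cmod_opp in H. lra.
    - pose proof (Cmod_triangle (u * S0) (X - u * S0)) as H.
      replace (u * S0 + (X - u * S0))%C with X in H by ring. lra. }
  apply Rabs_le_between in HXS.
  set (s := 1 - b ^ 2 * Cmod X ^ 2).
  (* 422 / 10 ^ 10 is about 2 b ^ 2 S0 times the error 142 / 10 ^ 7 of |X|. Multiplied by 6, it
     takes half of the tolerance. *)
  assert (Hs : Rabs (s - (1 - / gamma0 ^ 6)) <= 422 / 10 ^ 10).
  { assert (H1 : b ^ 2 * (S0 - 142 / 10 ^ 7) ^ 2 <= b ^ 2 * Cmod X ^ 2
                 <= b ^ 2 * (S0 + 142 / 10 ^ 7) ^ 2).
    { assert (0 <= S0 - 142 / 10 ^ 7) by enclose_cmp.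
      split; apply Rmult_le_compat_l; try apply pow2_ge_0; apply pow_incr; lra. }
    assert (H2 : / gamma0 ^ 6 - 422 / 10 ^ 10 <= b ^ 2 * (S0 - 142 / 10 ^ 7) ^ 2) by enclose_cmp.
    assert (H3 : b ^ 2 * (S0 + 142 / 10 ^ 7) ^ 2 <= / gamma0 ^ 6 + 422 / 10 ^ 10) by enclose_cmp.
    unfold s. apply Rabs_le; lra. }
  assert (Hg6 : 999 / 1000 <= 1 - / gamma0 ^ 6) by enclose_cmp.
  assert (Hs0 : 998 / 1000 <= s) by (apply Rabs_le_between in Hs; lra).
  assert (Hln : Rabs (ln s - ln (1 - / gamma0 ^ 6)) <= 422 / 10 ^ 10 / (998 / 1000)).
  { apply ln_sub_bound; auto; lra. }
  assert (HlnZ : Rabs (ln (Cmod (1 + z)%C) - Re z) <= 4 * (61 / 10 ^ 7) ^ 2).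
  { eapply Rle_trans; [apply ln_Cmod_1_add; lra|].
    apply Rmult_le_compat_l; [lra|]. apply pow_incr; split; auto using Cmod_ge_0. }
  pose proof (Cmod_disc_sub z _ HZ) as HZ1.
  assert (Hmain : Rabs (12 * Re z - Re zeta / 13824) <= 6 / 10 ^ 8).
  { assert (HC : Cmod (12 * z - zeta / 13824)%C <= 6 / 10 ^ 8).
    { assert (H12 : Cmod 12 = 12) by (rewrite Cmod_R; apply Rabs_right; lra).
      set (k := d3 / d0) in *.
      replace (12 * z - zeta / 13824)%C
        with (12 * (z - k * X ^ 3) + (12 * k * (X ^ 3 - (u * S0) ^ 3)
              + (12 * k * S0 ^ 3 - 1 / 13824)%R * zeta))%C.
      2:{ rewrite <- Eu, RtoC_minus, !RtoC_mult, RtoC_pow, RtoC_div by lra.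
          field. }
      pose proof (cube_sub_bound X (u * S0) _ _ HuS HX) as H3.
      eapply Rle_trans; [apply Cmod_triangle|].
      eapply Rle_trans; [apply Rplus_le_compat_l, Cmod_triangle|].
      rewrite !Cmod_mult, H12, Hzeta, !Cmod_R.
      assert (Hk : Rabs k <= 1112 / 10 ^ 6) by (unfold k; enclose_cmp).
      (* The coefficient 1 / 13824 = 24 ^ (-3) is recognized numerically as 12 (d3 / d0) S0 ^ 3. *)
      assert (Hk3 : Rabs (12 * k * S0 ^ 3 - 1 / 13824) <= 1 / 10 ^ 10) by (unfold k; enclose_cmp).
      assert (H4 : 12 * Rabs k * Cmod (X ^ 3 - (u * S0) ^ 3)%C
              <= 12 * (1112 / 10 ^ 6) * (142 / 10 ^ 7 * (3 * (S0 + 142 / 10 ^ 7) ^ 2))).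
      { apply Rmult_le_compat; auto using Cmod_ge_0.
        - pose proof (Rabs_pos k). lra.
        - lra. }
      assert (H5 : 12 * (3 / 10 ^ 9 / d0)
                   + 12 * (1112 / 10 ^ 6) * (142 / 10 ^ 7 * (3 * (S0 + 142 / 10 ^ 7) ^ 2))
                   + 1 / 10 ^ 10 <= 6 / 10 ^ 8) by enclose_cmp.
      lra. }
    eapply Rle_trans; [|exact HC]. eapply Rle_trans; [|apply re_le_Cmod].
    right; f_equal.
    destruct z as [z1 z2], zeta as [x y]. unfold Cdiv, Re; cbn. field. }
  assert (Eg : g_hyp zeta = g_infty (tau_of w)).
  { rewrite Hg by auto. rewrite (j_inv_of_root u w Hw E), Eu. auto. }
  rewrite Eg, g_infty_of_root, gamma1_eq by (fold X z; fold s; auto; lra).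
  fold X z; fold s.
  pose proof constant_term as HK.
  apply Rabs_le_between in HK. apply Rabs_le_between in Hln.
  apply Rabs_le_between in HlnZ. apply Rabs_le_between in Hmain.
  (* The constant term, the two logarithms and the linear term contribute about 0.1, 2.54, 0.02 and
     0.6 times 10 ^ (-7), less than 3.3 / 10 ^ 7 in all. *)
  apply Rabs_le. lra.
Qed.
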